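(* Let $f:\Delta\to\mathbb{R}$ be monotonic. For every vertex $i\in[n]$, degree $q\ge0$, and multidegree $\alpha\in\mathbb{Z}^n$, the persistence module $\mathbb V^q_{i,\alpha}(f)$ is pointwise finite-dimensional and constructible with critical values contained in the finite set $\operatorname{Crit}(f)=\{f(\tau):\tau\in\Delta\}$. Equivalently, as a finite-type $\mathbb{R}^{\mathrm{op}}$-indexed persistence module, it has a finite interval decomposition $$\mathbb V^q_{i,\alpha}(f)\cong\bigoplus_{\ell=1}^{N_{i,q,\alpha}}k_{J_\ell},$$ unique up to permutation of the interval summands. The finite family of isomorphism types that must be retained is the face-indexed family $$\{\mathbb V^q_{i,(0;-\mathbf 1_\sigma)}(f):\sigma\in\operatorname{del}_\Delta(i)\}\cup\{\mathbb V^q_{i,(1;-\mathbf 1_\sigma)}(f):\sigma\in\operatorname{lk}_\Delta(i)\},$$ i.e. every $\mathbb V^q_{i,\alpha}(f)$ is either zero or isomorphic to a member of this family; in particular, every such module is $q$-tame.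
   Context: $k$ is a field, $[n]=\{1,\dots,n\}$, $S=k[x_1,\dots,x_n]$ with the $\mathbb{Z}^n$-grading $\deg x_j=\mathbf e_j$. $\Delta$ is a simplicial complex on $[n]$ (a family of subsets closed under passing to subsets) of which every singleton is a face. For any complex $\Gamma$ on $[n]$, $I_\Gamma\subseteq S$ is generated by the monomials $\prod_{j\in\tau}x_j$, $\tau\subseteq[n]$, $\tau\notin\Gamma$, and $k[\Gamma]=S/I_\Gamma$ (zero for the void complex). $f:\Delta\to\mathbb{R}$ is monotonic if $f(\tau)\le f(\sigma)$ whenever $\tau\subseteq\sigma$; $\Delta^t_f=\{\sigma\in\Delta:f(\sigma)\le t\}$. For $s\le t$ the surjection $k[\Delta^t_f]\twoheadrightarrow k[\Delta^s_f]$ induces $\mathbb{Z}^n$-graded maps $\theta^{t\to s}_{i,q}:H^q_{\mathfrak p_i}(k[\Delta^t_f])\to H^q_{\mathfrak p_i}(k[\Delta^s_f])$, where $\mathfrak p_i=(x_j:j\ne i)\subseteq S$. An $\mathbb{R}^{\mathrm{op}}$-indexed persistence module is a functor $\mathbb{R}^{\mathrm{op}}\to\mathrm{Vec}_k$, i.e. spaces $V_t$ and compatible maps $V_t\to V_s$ for $s\le t$. $\mathbb V^q_{i,\alpha}(f)$ is the one with $V_t=H^q_{\mathfrak p_i}(k[\Delta^t_f])_\alpha$ and structure maps the restrictions of $\theta^{t\to s}_{i,q}$ to multidegree $\alpha$. Pointwise finite-dimensional means every $V_t$ is finite-dimensional; constructible with critical values in $C$ ($C$ finite) means $V_t\to V_s$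 is an isomorphism whenever $[s,t]\cap C=\varnothing$; $q$-tame (here $q$ is not the cohomological degree) means all structure maps $V_t\to V_s$ with $s<t$ have finite rank. For an interval $J\subseteq\mathbb{R}$, $k_J$ is the $\mathbb{R}^{\mathrm{op}}$-indexed module equal to $k$ on $J$ and $0$ elsewhere, with identity maps within $J$. Multidegrees are written $\alpha=(c;b)$ with $c=\alpha_i$ and $b=(\alpha_j)_{j\ne i}$; $\mathbf 1_\sigma=\sum_{j\in\sigma}\mathbf e_j$. $\operatorname{del}_\Delta(i)=\{\tau\in\Delta:i\notin\tau\}$ and $\operatorname{lk}_\Delta(i)=\{\tau\subseteq[n]\setminus\{i\}:\tau\cup\{i\}\in\Delta\}$. *)

(* Defs.v *)
From HB Require Import structures.
From mathcomp Require Import all_boot all_order all_algebra generic_quotient.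
From mathcomp Require Import ring_quotient.
From mathcomp Require Import boolp classical_sets functions set_interval.
From mathcomp Require Import cardinality reals.
From mathcomp Require Import num_normedtype(is_interval).
From mathcomp Require Import mpoly.
From mathcomp Require Import ring.

Set Implicit Arguments.
Unset Strict Implicit.
Unset Printing Implicit Defensive.

Import Order.TTheory GRing.Theory Num.Theory.

Local Open Scope ring_scope.
Local Open Scope quotient_scope.

Local Notation funext_dep := functional_extensionality_dep.

Section Submodule.
Variables (A : nzRingType) (V : lmodType A) (N : submodClosed V).

Record submod := Submod { submod_val :> V; _ : submod_val \in N }.

HB.instance Definition _ := [isSub for submod_val].
HB.instance Definition _ := [Choice of submod by <:].
HB.instance Definition _ := [SubChoice_isSubLmodule of submod by <:].

Lemma submodP (x : submod) : submod_val x \in N.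
Proof. by case: x. Qed.

Lemma submod_inj (x y : submod) : submod_val x = submod_val y -> x = y.
Proof. exact: val_inj. Qed.

End Submodule.

Section SubmoduleMap.
Variables (A : nzRingType) (V V' : lmodType A).
Variables (N : submodClosed V) (N' : submodClosed V').
Variable phi : {linear V -> V'}.
Hypothesis phiN : {in N, forall v, phi v \in N'}.

Definition submod_map (x : submod N) : submod N' := Submod (phiN (submodP x)).

Lemma submod_map_linear : linear submod_map.
Proof. by move=> a x y; apply: submod_inj; rewrite /= !linearP. Qed.

HB.instance Definition _ :=
  GRing.isLinear.Build A (submod N) (submod N') _ submod_map submod_map_linear.

End SubmoduleMap.

Section QuotientModule.
Variables (A : nzRingType) (V : lmodType A) (N : submodClosed V).

(* [submodClosed] does not inherit from [zmodClosed], which [Quotient] needs *)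
Definition submod_zmod : {pred V} := [pred v | v \in N].

Fact submod_zmod_closed : zmod_closed submod_zmod.
Proof.
split=> [|u v]; rewrite ?inE ?rpred0 // => uN vN.
by rewrite -scaleN1r rpredD ?rpredZ.
Qed.

HB.instance Definition _ := GRing.isZmodClosed.Build V submod_zmod
  submod_zmod_closed.

Definition quotmod := Quotient.quot submod_zmod.

HB.instance Definition _ := GRing.Zmodule.on quotmod.

Definition quotpi (v : V) : quotmod := \pi_(Quotient.quot submod_zmod) v.

Lemma quotpi_eq u v : (quotpi u = quotpi v) <-> (u - v \in N).
Proof.
rewrite -[u - v \in N]/(u - v \in submod_zmod) Quotient.idealrBE.
by split=> [/eqP|] // /eqP.
Qed.

Lemma quotpiK x : quotpi (repr x) = x.
Proof. exact: reprK. Qed.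

Lemma quotpiD u v : quotpi (u + v) = quotpi u + quotpi v.
Proof. by rewrite /quotpi !piE. Qed.

Definition quot_scale (a : A) (x : quotmod) : quotmod := quotpi (a *: repr x).

Lemma quot_scale_pi a v : quot_scale a (quotpi v) = quotpi (a *: v).
Proof.
apply/quotpi_eq; rewrite -scalerBr rpredZ //.
by apply/quotpi_eq; rewrite quotpiK.
Qed.

Fact quot_scaleA a b x : quot_scale a (quot_scale b x) = quot_scale (a * b) x.
Proof. by rewrite -[x]quotpiK !quot_scale_pi scalerA. Qed.

Fact quot_scale1 : left_id 1 quot_scale.
Proof. by move=> x; rewrite -[x]quotpiK quot_scale_pi scale1r. Qed.

Fact quot_scaleDr : right_distributive quot_scale +%R.
Proof.
move=> a x y; rewrite -[x]quotpiK -[y]quotpiK.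
by rewrite !(quot_scale_pi, =^~ quotpiD) scalerDr.
Qed.

Fact quot_scaleDl x : {morph quot_scale^~ x : a b / a + b}.
Proof.
by move=> a b /=; rewrite -[x]quotpiK !(quot_scale_pi, =^~ quotpiD) scalerDl.
Qed.

HB.instance Definition _ := GRing.Zmodule_isLmodule.Build A quotmod
  quot_scaleA quot_scale1 quot_scaleDr quot_scaleDl.

Lemma quotpi_linear : linear quotpi.
Proof. by move=> a u v; rewrite quotpiD -quot_scale_pi. Qed.

HB.instance Definition _ :=
  GRing.isLinear.Build A V quotmod _ quotpi quotpi_linear.

End QuotientModule.

Section QuotientMap.
Variables (A : nzRingType) (V V' : lmodType A).
Variables (N : submodClosed V) (N' : submodClosed V').
Variable phi : {linear V -> V'}.
Hypothesis phiN : {in N, forall v, phi v \in N'}.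

Definition quot_map of {in N, forall v, phi v \in N'} :
    quotmod N -> quotmod N' :=
  fun x => quotpi N' (phi (repr x)).

Lemma quot_map_pi v : quot_map phiN (quotpi N v) = quotpi N' (phi v).
Proof.
apply/quotpi_eq; rewrite -linearB; apply: phiN.
by apply/quotpi_eq; rewrite quotpiK.
Qed.

Lemma quot_map_linear : linear (quot_map phiN).
Proof.
move=> a x y; rewrite -[x]quotpiK -[y]quotpiK -linearP !quot_map_pi.
by rewrite !linearP.
Qed.

HB.instance Definition _ := GRing.isLinear.Build A (quotmod N) (quotmod N') _
  (quot_map phiN) quot_map_linear.

End QuotientMap.

Section DependentProduct.
Variables (A : nzRingType) (I : Type) (V : I -> lmodType A).

Definition dprod := forall i, V i.

HB.instance Definition _ := gen_eqMixin dprod.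
HB.instance Definition _ := gen_choiceMixin dprod.

Definition dprod_zero : dprod := fun=> 0.
Definition dprod_opp (u : dprod) : dprod := fun i => - u i.
Definition dprod_add (u v : dprod) : dprod := fun i => u i + v i.
Definition dprod_scale (a : A) (u : dprod) : dprod := fun i => a *: u i.

Fact dprod_addA : associative dprod_add.
Proof. by move=> u v w; apply: funext_dep => i; apply: addrA. Qed.
Fact dprod_addC : commutative dprod_add.
Proof. by move=> u v; apply: funext_dep => i; apply: addrC. Qed.
Fact dprod_add0 : left_id dprod_zero dprod_add.
Proof. by move=> u; apply: funext_dep => i; apply: add0r. Qed.
Fact dprod_addN : left_inverse dprod_zero dprod_opp dprod_add.
Proof. by move=> u; apply: funext_dep => i; apply: addNr. Qed.

HB.instance Definition _ := GRing.isZmodule.Build dprod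
  dprod_addA dprod_addC dprod_add0 dprod_addN.

Fact dprod_scaleA a b u : dprod_scale a (dprod_scale b u) = dprod_scale (a * b) u.
Proof. by apply: funext_dep => i; apply: scalerA. Qed.
Fact dprod_scale1 : left_id 1 dprod_scale.
Proof. by move=> u; apply: funext_dep => i; apply: scale1r. Qed.
Fact dprod_scaleDr : right_distributive dprod_scale +%R.
Proof. by move=> a u v; apply: funext_dep => i; apply: scalerDr. Qed.
Fact dprod_scaleDl u : {morph dprod_scale^~ u : a b / a + b}.
Proof. by move=> a b; apply: funext_dep => i; apply: scalerDl. Qed.

HB.instance Definition _ := GRing.Zmodule_isLmodule.Build A dprod
  dprod_scaleA dprod_scale1 dprod_scaleDr dprod_scaleDl.

End DependentProduct.

Section DependentProductMap.
Variables (A : nzRingType) (I : Type) (V V' : I -> lmodType A).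
Variable phi : forall i, {linear V i -> V' i}.

Definition dprod_map (u : dprod V) : dprod V' := fun i => phi i (u i).

Lemma dprod_map_linear : linear dprod_map.
Proof.
move=> a u v; apply: funext_dep => i.
by rewrite /dprod_map linearP.
Qed.

HB.instance Definition _ := GRing.isLinear.Build A (dprod V) (dprod V') _
  dprod_map dprod_map_linear.

End DependentProductMap.

Section RestrictionOfScalars.
Variables (k : fieldType) (n : nat).

Definition restr (V : lmodType {mpoly k[n]}) : Type := V.

Section Instance.
Variable V : lmodType {mpoly k[n]}.

HB.instance Definition _ := GRing.Zmodule.copy (restr V) V.

Definition restr_scale (c : k) (v : restr V) : restr V := c%:MP *: (v : V).

Fact restr_scaleA a b v : restr_scale a (restr_scale b v) = restr_scale (a * b) v.
Proof. by rewrite /restr_scale scalerA mpolyCM. Qed.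
Fact restr_scale1 : left_id 1 restr_scale.
Proof. by move=> v; rewrite /restr_scale mpolyC1 scale1r. Qed.
Fact restr_scaleDr : right_distributive restr_scale +%R.
Proof. by move=> a u v; apply: scalerDr. Qed.
Fact restr_scaleDl v : {morph restr_scale^~ v : a b / a + b}.
Proof. by move=> a b; rewrite /restr_scale mpolyCD; apply: scalerDl. Qed.

HB.instance Definition _ := GRing.Zmodule_isLmodule.Build k (restr V)
  restr_scaleA restr_scale1 restr_scaleDr restr_scaleDl.
End Instance.

Definition restr_map (V V' : lmodType {mpoly k[n]}) (phi : {linear V -> V'}) :
  restr V -> restr V' := phi.

Lemma restr_map_linear (V V' : lmodType {mpoly k[n]})
    (phi : {linear V -> V'}) : linear (restr_map phi).
Proof. by move=> a u v; apply: (linearP phi). Qed.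

HB.instance Definition _ (V V' : lmodType {mpoly k[n]})
    (phi : {linear V -> V'}) := GRing.isLinear.Build k (restr V) (restr V') _
    (restr_map phi) (restr_map_linear phi).

End RestrictionOfScalars.

Section Localization.
Variables (A : comNzRingType) (W : mulrClosed A) (M : lmodType A).

Definition denom := {w : A | w \in W}.
Definition fraction := (M * denom)%type.

Definition denom1 : denom := exist _ 1 (rpred1 W).
Definition denomM (v w : denom) : denom :=
  exist _ (sval v * sval w) (rpredM (valP v) (valP w)).

Definition fraction_eq (x y : fraction) : bool :=
  `[< exists2 u, u \in W & u *: (sval y.2 *: x.1) = u *: (sval x.2 *: y.1) >].

Lemma fraction_equiv : equiv_class_of fraction_eq.
Proof.
split.
- by move=> x; apply/asboolP; exists 1; rewrite ?rpred1.
- by move=> x y; apply/asboolP/asboolP=> -[u uW e]; exists u.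
move=> y x z /asboolP[u uW e1] /asboolP[v vW e2]; apply/asboolP.
exists (u * v * sval y.2); first by rewrite !rpredM //; apply: valP.
transitivity ((v * sval z.2) *: (u *: (sval y.2 *: x.1))).
  by rewrite !scalerA; congr (_ *: _); ring.
rewrite e1; transitivity ((u * sval x.2) *: (v *: (sval z.2 *: y.1))).
  by rewrite !scalerA; congr (_ *: _); ring.
by rewrite e2 !scalerA; congr (_ *: _); ring.
Qed.

Canonical fraction_equivRel := EquivRelPack fraction_equiv.
Canonical fraction_encModRel := defaultEncModRel fraction_eq.

Definition loc := {eq_quot fraction_eq}.
HB.instance Definition _ := Choice.on loc.

Definition mkfrac (m : M) (w : denom) : loc :=
  \pi_({eq_quot fraction_eq}) (m, w).

Lemma mkfracP m v m' v' :
  mkfrac m v = mkfrac m' v' <->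
  exists2 u, u \in W & u *: (sval v' *: m) = u *: (sval v *: m').
Proof.
split=> [/eqquotP/asboolP //|h].
by apply/eqquotP/asboolP.
Qed.

Lemma loc_ind (P : loc -> Prop) :
  (forall m w, P (mkfrac m w)) -> forall x, P x.
Proof. by move=> h x; rewrite -[x]reprK; case: (repr x) => m w; apply: h. Qed.

Definition loc_zero : loc := mkfrac 0 denom1.
Definition loc_opp (x : loc) : loc := mkfrac (- (repr x).1) (repr x).2.
Definition loc_add (x y : loc) : loc :=
  mkfrac (sval (repr y).2 *: (repr x).1 + sval (repr x).2 *: (repr y).1)
         (denomM (repr x).2 (repr y).2).
Definition loc_scale (a : A) (x : loc) : loc :=
  mkfrac (a *: (repr x).1) (repr x).2.

Lemma repr_mkfrac m w : exists2 u, u \in W &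
  u *: (sval w *: (repr (mkfrac m w)).1) = u *: (sval (repr (mkfrac m w)).2 *: m).
Proof. by apply/mkfracP; rewrite -[RHS]reprK; case: (repr _). Qed.

Lemma loc_opp_frac m w : loc_opp (mkfrac m w) = mkfrac (- m) w.
Proof.
have [u uW e] := repr_mkfrac m w.
by apply/mkfracP; exists u; rewrite // !scalerN e.
Qed.

Lemma loc_scale_frac a m w : loc_scale a (mkfrac m w) = mkfrac (a *: m) w.
Proof.
have [u uW e] := repr_mkfrac m w.
apply/mkfracP; exists u => //.
transitivity (a *: (u *: (sval w *: (repr (mkfrac m w)).1))).
  by rewrite !scalerA; congr (_ *: _); ring.
by rewrite e !scalerA; congr (_ *: _); ring.
Qed.

Lemma loc_add_frac m v m' v' :
  loc_add (mkfrac m v) (mkfrac m' v') =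
  mkfrac (sval v' *: m + sval v *: m') (denomM v v').
Proof.
have [u uW e] := repr_mkfrac m v; have [u' uW' e'] := repr_mkfrac m' v'.
rewrite /loc_add; set r := repr _ in e *; set r' := repr _ in e' *.
apply/mkfracP; exists (u * u'); first exact: rpredM.
rewrite /= !scalerDr; congr (_ + _).
  transitivity ((u' * sval v' * sval r'.2) *: (u *: (sval v *: r.1))).
  by rewrite !scalerA; congr (_ *: _); ring.
  by rewrite e !scalerA; congr (_ *: _); ring.
transitivity ((u * sval v * sval r.2) *: (u' *: (sval v' *: r'.1))).
  by rewrite !scalerA; congr (_ *: _); ring.
by rewrite e' !scalerA; congr (_ *: _); ring.
Qed.

Lemma eq_mkfrac m v m' v' :
  sval v' *: m = sval v *: m' -> mkfrac m v = mkfrac m' v'.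
Proof. by move=> e; apply/mkfracP; exists 1; rewrite ?rpred1 ?e. Qed.

Fact loc_addA : associative loc_add.
Proof.
elim/loc_ind=> m v; elim/loc_ind=> m' v'; elim/loc_ind=> m'' v''.
rewrite !loc_add_frac; apply: eq_mkfrac.
rewrite /= !scalerDr !scalerA -!addrA.
by congr (_ *: _ + (_ *: _ + _ *: _)); ring.
Qed.

Fact loc_addC : commutative loc_add.
Proof.
elim/loc_ind=> m v; elim/loc_ind=> m' v'; rewrite !loc_add_frac.
by apply: eq_mkfrac; rewrite /= [sval v' *: m + _]addrC [sval v' * _]mulrC.
Qed.

Fact loc_add0 : left_id loc_zero loc_add.
Proof.
elim/loc_ind=> m v; rewrite loc_add_frac; apply: eq_mkfrac.
by rewrite /= scaler0 add0r !scalerA; congr (_ *: _); ring.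
Qed.

Fact loc_addN : left_inverse loc_zero loc_opp loc_add.
Proof.
elim/loc_ind=> m v; rewrite loc_opp_frac loc_add_frac; apply: eq_mkfrac.
by rewrite /= scalerN addNr !scaler0.
Qed.

HB.instance Definition _ := GRing.isZmodule.Build loc
  loc_addA loc_addC loc_add0 loc_addN.

Fact loc_scaleA a b x : loc_scale a (loc_scale b x) = loc_scale (a * b) x.
Proof. by elim/loc_ind: x => m v; rewrite !loc_scale_frac scalerA. Qed.

Fact loc_scale1 : left_id 1 loc_scale.
Proof. by elim/loc_ind=> m v; rewrite loc_scale_frac scale1r. Qed.

Fact loc_scaleDr : right_distributive loc_scale +%R.
Proof.
move=> a; elim/loc_ind=> m v; elim/loc_ind=> m' v'.
rewrite [mkfrac m v + _]loc_add_frac !loc_scale_frac [RHS]loc_add_frac.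
by congr mkfrac; rewrite scalerDr !scalerA; congr (_ *: _ + _ *: _); ring.
Qed.

Fact loc_scaleDl x : {morph loc_scale^~ x : a b / a + b}.
Proof.
move=> a b /=; elim/loc_ind: x => m v; rewrite !loc_scale_frac [RHS]loc_add_frac.
apply: eq_mkfrac; rewrite /= -scalerDr -scalerDl !scalerA.
by congr (_ *: _); ring.
Qed.

HB.instance Definition _ := GRing.Zmodule_isLmodule.Build A loc
  loc_scaleA loc_scale1 loc_scaleDr loc_scaleDl.

Lemma mkfracD m v m' v' :
  mkfrac m v + mkfrac m' v' = mkfrac (sval v' *: m + sval v *: m') (denomM v v').
Proof. exact: loc_add_frac. Qed.

Lemma mkfracZ a m w : a *: mkfrac m w = mkfrac (a *: m) w.
Proof. exact: loc_scale_frac. Qed.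

End Localization.

Section LocalizationMap.
Variables (A : comNzRingType) (W : mulrClosed A) (M M' : lmodType A).
Variable phi : {linear M -> M'}.

Definition loc_map (x : loc W M) : loc W M' :=
  mkfrac (phi (repr x).1) (repr x).2.

Lemma loc_map_frac m w : loc_map (mkfrac m w) = mkfrac (phi m) w.
Proof.
have [u uW e] := repr_mkfrac m w.
apply/mkfracP; exists u => //.
by rewrite -!(linearZ_LR phi) e.
Qed.

Lemma loc_map_linear : linear loc_map.
Proof.
move=> a; elim/loc_ind=> m v; elim/loc_ind=> m' v'.
rewrite mkfracZ mkfracD !loc_map_frac mkfracZ mkfracD.
by rewrite !(linearD phi) !(linearZ_LR phi).
Qed.

HB.instance Definition _ := GRing.isLinear.Build A (loc W M) (loc W M') _
  loc_map loc_map_linear.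

End LocalizationMap.

Section LocalizationRestriction.
Variables (A : comNzRingType) (W W' : mulrClosed A) (M : lmodType A).
Hypothesis sWW' : {subset W <= W'}.

Definition denom_incl (w : denom W) : denom W' :=
  exist _ (sval w) (sWW' (valP w)).

Definition loc_res (x : loc W M) : loc W' M :=
  mkfrac (repr x).1 (denom_incl (repr x).2).

Lemma loc_res_frac m w : loc_res (mkfrac m w) = mkfrac m (denom_incl w).
Proof.
have [u uW e] := repr_mkfrac m w.
by apply/mkfracP; exists u; first exact: sWW'.
Qed.

Lemma loc_res_linear : linear loc_res.
Proof.
move=> a; elim/loc_ind=> m v; elim/loc_ind=> m' v'.
rewrite mkfracZ mkfracD !loc_res_frac mkfracZ mkfracD.
exact: eq_mkfrac.
Qed.

HB.instance Definition _ := GRing.isLinear.Build A (loc W M) (loc W' M) _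
  loc_res loc_res_linear.

End LocalizationRestriction.

(* The local cohomology of an [S]-module [M] supported at the ideal generated by
   the variables [x_j], [j \in A], is the cohomology of the Cech complex
     0 -> M -> \oplus_j M_(x_j) -> \oplus_(j < l) M_(x_j x_l) -> ...
   on these variables. [locT M T] is [M] localized at [\prod_(j in T) x_j], the
   denominators being all monomials in the [x_j], [j \in T]. *)

Section CechComplex.
Variables (k : fieldType) (n : nat).
Local Notation S := {mpoly k[n]}.

Definition monomials_in (T : {set 'I_n}) : {pred S} := fun w =>
  `[< exists2 a : 'X_{1..n}, (forall j, j \notin T -> a j = 0%N) &
        w = 'X_[a] >].

Fact monomials_in_mulr_closed T : mulr_closed (monomials_in T).
Proof.
split; first by apply/asboolP; exists 0%MM => [j _|]; rewrite ?mnmE ?mpolyX0.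
move=> v w /asboolP[a aT ->] /asboolP[b bT ->]; apply/asboolP.
exists (a + b)%MM => [j jT|]; last by rewrite mpolyXD.
by rewrite mnmDE aT ?bT.
Qed.

HB.instance Definition _ T :=
  GRing.isMulClosed.Build S (monomials_in T) (monomials_in_mulr_closed T).

Lemma monomials_inS (T T' : {set 'I_n}) : T \subset T' ->
  {subset monomials_in T <= monomials_in T'}.
Proof.
move=> /fintype.subsetP sTT' w /asboolP[a aT ->]; apply/asboolP; exists a => // j.
by move=> jT'; apply: aT; apply: contra jT' => /sTT'.
Qed.

Definition locT (M : lmodType S) (T : {set 'I_n}) : lmodType S :=
  loc (monomials_in T) M.

Definition face_res (M : lmodType S) (T : {set 'I_n}) (j : 'I_n) :
  {linear locT M (T :\ j) -> locT M T} :=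
  @loc_res _ _ _ M (monomials_inS (subD1set T j)).

Section Module.
Variables (M : lmodType S) (A : {set 'I_n}).

(* All the cochain spaces at once; the ones of degree [q] are the families
   which vanish outside of the subsets of [A] of cardinality [q] *)
Definition cochains := dprod (locT M).

Definition is_cochain (q : nat) (c : cochains) : Prop :=
  forall T : {set 'I_n}, ~~ ((T \subset A) && (#|T| == q)) -> c T = 0.

Definition cech_d (c : cochains) : cochains := fun T =>
  if T \subset A then
    \sum_(j in T)
      (-1) ^+ #|[set l in T | (l < j)%N]| *: face_res M T j (c (T :\ j))
  else 0.

Lemma cech_d_linear : linear cech_d.
Proof.
move=> a c c'; apply: funext_dep => T.
rewrite /cech_d -[RHS]/(a *: (if _ then _ else _) + (if _ then _ else _)).
case: ifP => _; last by rewrite scaler0 addr0.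
rewrite scaler_sumr -big_split /=; apply: eq_bigr => j _.
rewrite [face_res _ _ _ _](linearP (face_res M T j)) scalerDr.
by congr (_ + _); rewrite !scalerA mulrC.
Qed.

HB.instance Definition _ :=
  GRing.isLinear.Build S cochains cochains _ cech_d cech_d_linear.

Lemma face_res_swap (c : cochains) T j l :
  face_res M T j (face_res M (T :\ j) l (c (T :\ j :\ l))) =
  face_res M T l (face_res M (T :\ l) j (c (T :\ l :\ j))).
Proof.
have E T1 T2 (s1 : {subset monomials_in T1 <= monomials_in T})
    (s2 : {subset monomials_in T2 <= monomials_in T}) : T1 = T2 ->
    @loc_res _ _ _ M s1 (c T1) = @loc_res _ _ _ M s2 (c T2).
  by move=> e; rewrite -e in s2 *; congr loc_res; apply: Prop_irrelevance.
have F T1 T2 (s1 : {subset monomials_in T1 <= monomials_in T2})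
    (s2 : {subset monomials_in T2 <= monomials_in T}) (x : locT M T1) :
    @loc_res _ _ _ M s2 (@loc_res _ _ _ M s1 x) =
    @loc_res _ _ _ M (fun w h => s2 w (s1 w h)) x.
  elim/loc_ind: x => m w; rewrite [X in loc_res s2 X]loc_res_frac.
  by rewrite [LHS]loc_res_frac [RHS]loc_res_frac; apply: eq_mkfrac.
rewrite [LHS]F [RHS]F; apply: E.
by rewrite !finset.setDDl finset.setUC.
Qed.

Lemma cech_dd c : cech_d (cech_d c) = 0.
Proof.
apply: funext_dep => T; rewrite {1}/cech_d.
case: ifP => // sTA.
pose e (T : {set 'I_n}) (j : 'I_n) : S := (-1) ^+ #|[set l in T | (l < j)%N]|.
pose F j l := face_res M T j (face_res M (T :\ j) l (c (T :\ j :\ l))).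
pose G j l := (e T j * e (T :\ j) l) *: F j l.
transitivity (\sum_(j in T) \sum_(l in T | l != j) G j l).
  apply: eq_bigr => j jT.
  rewrite /cech_d (fintype.subset_trans (subD1set T j) sTA).
  rewrite linear_sum scaler_sumr.
  apply: eq_big => [l|l _]; first by rewrite !inE andbC.
  by rewrite (linearZ_LR (face_res M T j)) scalerA.
transitivity (\sum_(j in T) \sum_(l in T | (l < j)%N) (G j l + G l j)).
  transitivity (\sum_(j in T) (\sum_(l in T | (l < j)%N) G j l +
                               \sum_(l in T | (j < l)%N) G j l)).
    apply: eq_bigr => j _; rewrite (bigID (fun l : 'I_n => l < j)%N) /=.
    congr (_ + _); apply: eq_bigl => l; rewrite -andbA; congr (_ && _);
      rewrite -(inj_eq val_inj) /=; by case: ltngtP.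
  rewrite big_split /= [X in _ + X](exchange_big_dep (mem T)) //=; last first.
    by move=> j l _ /andP[].
  rewrite -big_split; apply: eq_bigr => j jT; rewrite big_split /=.
  by congr (_ + _); apply: eq_bigl => l; rewrite jT.
apply: big1 => j jT; apply: big1 => l /andP[lT llj].
rewrite /G {2}/F -face_res_swap -/(F j l) -scalerDl.
suff -> : e T j * e (T :\ j) l + e T l * e (T :\ l) j = 0 by rewrite scale0r.
have -> : e (T :\ j) l = e T l.
  congr (_ ^+ _); apply: eq_card => m; rewrite !inE.
  case: (m =P j) => [->|//]; rewrite ltnNge (ltnW llj) !andbF //.
have -> : e T j = - e (T :\ l) j.
  rewrite /e (cardsD1 l) !inE lT llj exprS mulN1r; congr (- (_ ^+ _)).
  by apply: eq_card => m; rewrite !inE andbA.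
by rewrite mulNr mulrC addNr.
Qed.

Lemma is_cochain0 q : is_cochain q 0.
Proof. by []. Qed.

Lemma is_cochainP q a c c' :
  is_cochain q c -> is_cochain q c' -> is_cochain q (a *: c + c').
Proof.
move=> hc hc' T hT; rewrite -[LHS]/(a *: c T + c' T).
by rewrite hc ?hc' ?scaler0 ?addr0.
Qed.

Definition cocycles (q : nat) : {pred cochains} := fun c =>
  `[< is_cochain q c /\ cech_d c = 0 >].

Fact cocycles_closed q : subsemimod_closed (cocycles q).
Proof.
apply: GRing.submod_closed_semi; split.
  by apply/asboolP; split; rewrite ?linear0.
move=> a u v /asboolP[hu du] /asboolP[hv dv]; apply/asboolP.
by split; [apply: is_cochainP | rewrite (linearP cech_d) /= du dv scaler0 addr0].
Qed.

HB.instance Definition _ q :=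
  GRing.isSubmodClosed.Build S cochains (cocycles q) (cocycles_closed q).

Definition coboundaries (q : nat) : {pred submod (cocycles q)} := fun z =>
  `[< if q is p.+1 then exists2 b, is_cochain p b & submod_val z = cech_d b
      else z = 0 >].
Arguments coboundaries q z : clear implicits.

Fact coboundaries_closed q : subsemimod_closed (coboundaries q).
Proof.
apply: GRing.submod_closed_semi; split.
  by apply/asboolP; case: q => // q; exists 0; rewrite ?linear0.
move=> a u v; case: q u v => [|q] u v /asboolP hu /asboolP hv; apply/asboolP.
  by rewrite hu hv scaler0 addr0.
case: hu hv => [b hb eu] [b' hb' ev]; exists (a *: b + b').
  exact: is_cochainP.
by rewrite (linearP cech_d) /= -eu -ev.
Qed.

HB.instance Definition _ q := GRing.isSubmodClosed.Build S
  (submod (cocycles q)) (coboundaries q) (coboundaries_closed q).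

Definition local_cohomology (q : nat) : lmodType S := quotmod (coboundaries q).

End Module.

Arguments coboundaries {M} A q z.

Section Functoriality.
Variables (M M' : lmodType S) (A : {set 'I_n}) (phi : {linear M -> M'}).

Definition locT_map (T : {set 'I_n}) : {linear locT M T -> locT M' T} :=
  @loc_map _ (monomials_in T) M M' phi.

Definition cech_map : {linear cochains M -> cochains M'} :=
  dprod_map locT_map.

Lemma face_res_map T j x :
  face_res M' T j (locT_map (T :\ j) x) = locT_map T (face_res M T j x).
Proof.
elim/loc_ind: x => m w; rewrite [locT_map _ _]loc_map_frac.
rewrite [face_res _ _ _ _]loc_res_frac [face_res _ _ _ _]loc_res_frac.
by rewrite [RHS]loc_map_frac.
Qed.

Lemma cech_map_d c : cech_d A (cech_map c) = cech_map (cech_d A c).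
Proof.
apply: funext_dep => T.
rewrite /cech_d -[RHS]/(locT_map T (if _ then _ else _)).
case: ifP => _; last by rewrite linear0.
rewrite linear_sum; apply: eq_bigr => j _ /=.
by rewrite [RHS](linearZ_LR (locT_map T)) -face_res_map.
Qed.

Lemma cech_map_cochain q c : is_cochain A q c -> is_cochain A q (cech_map c).
Proof. by move=> hc T hT; rewrite -[LHS]/(locT_map T (c T)) hc ?linear0. Qed.

Lemma cech_map_cocycle q :
  {in cocycles (M := M) A q, forall c, cech_map c \in cocycles A q}.
Proof.
move=> c /asboolP[hc dc]; apply/asboolP; split; first exact: cech_map_cochain.
by rewrite cech_map_d dc linear0.
Qed.

Definition cocycle_map (q : nat) :
    {linear submod (cocycles (M := M) A q) -> submod (cocycles (M := M') A q)} :=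
  submod_map (cech_map_cocycle (q := q)).

Lemma cocycle_map_coboundary q : {in coboundaries (M := M) A q,
  forall z, cocycle_map q z \in coboundaries A q}.
Proof.
case: q => [|q] z /asboolP hz; apply/asboolP; first by rewrite hz linear0.
case: hz => b hb ez; exists (cech_map b); first exact: cech_map_cochain.
by rewrite cech_map_d -ez.
Qed.

Definition local_cohomology_map (q : nat) :
    {linear local_cohomology M A q -> local_cohomology M' A q} :=
  quot_map (cocycle_map_coboundary (q := q)).

End Functoriality.

Section FunctorialityLaws.
Variables (M1 M2 M3 : lmodType S) (A : {set 'I_n}) (q : nat).

Lemma locT_map_id (phi : {linear M1 -> M1}) : (forall m, phi m = m) ->
  forall T x, locT_map phi T x = x.
Proof.
move=> e T; elim/loc_ind=> m w.
by rewrite [locT_map _ _ _]loc_map_frac e.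
Qed.

Lemma locT_map_comp (phi : {linear M1 -> M2}) (psi : {linear M2 -> M3})
    (chi : {linear M1 -> M3}) : (forall m, psi (phi m) = chi m) ->
  forall T x, locT_map psi T (locT_map phi T x) = locT_map chi T x.
Proof.
move=> e T; elim/loc_ind=> m w; rewrite [locT_map phi _ _]loc_map_frac.
by rewrite [LHS]loc_map_frac e [RHS]loc_map_frac.
Qed.

Lemma quotpi_ind (V : lmodType S) (N : submodClosed V) (P : quotmod N -> Prop) :
  (forall v, P (quotpi N v)) -> forall x, P x.
Proof. by move=> h x; rewrite -[x]quotpiK. Qed.

Lemma local_cohomology_map_pi (M M' : lmodType S) (phi : {linear M -> M'}) z :
  local_cohomology_map A phi q (quotpi (coboundaries A q) z) =
  quotpi (coboundaries A q) (cocycle_map A phi q z).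
Proof. exact: quot_map_pi. Qed.

Lemma local_cohomology_map_id (phi : {linear M1 -> M1}) :
  (forall m, phi m = m) -> forall x, local_cohomology_map A phi q x = x.
Proof.
move=> e; elim/quotpi_ind => z; rewrite local_cohomology_map_pi.
congr quotpi; apply: submod_inj; apply: funext_dep => T.
exact: locT_map_id.
Qed.

Lemma local_cohomology_map_comp (phi : {linear M1 -> M2})
    (psi : {linear M2 -> M3}) (chi : {linear M1 -> M3}) :
  (forall m, psi (phi m) = chi m) -> forall x,
  local_cohomology_map A psi q (local_cohomology_map A phi q x) =
  local_cohomology_map A chi q x.
Proof.
move=> e; elim/quotpi_ind => z; rewrite !local_cohomology_map_pi.
congr quotpi; apply: submod_inj; apply: funext_dep => T.
exact: locT_map_comp.
Qed.

End FunctorialityLaws.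
End CechComplex.

Arguments coboundaries {k n M} A q z.

Section StanleyReisner.
Variables (k : fieldType) (n : nat).
Local Notation S := {mpoly k[n]}.
Implicit Types Gam : {set {set 'I_n}}.

Definition is_complex Gam : Prop :=
  forall tau sigma : {set 'I_n},
    tau \subset sigma -> sigma \in Gam -> tau \in Gam.

Definition SR_ideal Gam : {pred S^o} := fun p =>
  `[< exists g : {set 'I_n} -> S,
        p = \sum_(tau | tau \notin Gam) g tau * \prod_(j in tau) 'X_j >].

Fact SR_ideal_closed Gam : subsemimod_closed (SR_ideal Gam).
Proof.
apply: GRing.submod_closed_semi; split.
  by apply/asboolP; exists (fun=> 0); rewrite big1 // => tau _; rewrite mul0r.
move=> a u v /asboolP[g ->] /asboolP[h ->]; apply/asboolP.
exists (fun tau => a * g tau + h tau).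
rewrite [a *: _]mulr_sumr -big_split /=; apply: eq_bigr => tau _.
by rewrite mulrDl mulrA.
Qed.

HB.instance Definition _ Gam :=
  GRing.isSubmodClosed.Build S S^o (SR_ideal Gam) (SR_ideal_closed Gam).

Lemma SR_idealS Gam Gam' : Gam' \subset Gam ->
  {subset SR_ideal Gam <= SR_ideal Gam'}.
Proof.
move=> /fintype.subsetP sG p /asboolP[g ->]; apply/asboolP.
exists (fun tau => if tau \in Gam then 0 else g tau).
rewrite [RHS]big_mkcond [LHS]big_mkcond /=; apply: eq_bigr => tau _.
case: (boolP (tau \in Gam)) => h /=; first by rewrite mul0r if_same.
by rewrite (contra (@sG tau) h).
Qed.

(* [S / I_Gam]; this is zero when [Gam] is void, hence not a ring in the sense
   of [nzRingType], but only its [S]-module structure is needed *)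
Definition SR Gam : lmodType S := quotmod (SR_ideal Gam).

Fact SR_surj_subproof Gam Gam' : Gam' \subset Gam ->
  {in SR_ideal Gam, forall p : S^o,
    (idfun : {linear S^o -> S^o}) p \in SR_ideal Gam'}.
Proof. by move=> sG p; apply: SR_idealS. Qed.

Definition SR_surj Gam Gam' (sG : Gam' \subset Gam) :
    {linear SR Gam -> SR Gam'} :=
  quot_map (SR_surj_subproof sG).

Lemma SR_surj_pi Gam Gam' (sG : Gam' \subset Gam) (p : S^o) :
  SR_surj sG (quotpi (SR_ideal Gam) p) = quotpi (SR_ideal Gam') p.
Proof. exact: quot_map_pi. Qed.

Definition multidegree := {ffun 'I_n -> int}.

Definition mdegZ (a : 'X_{1..n}) : multidegree := [ffun j => (a j)%:Z].

Definition homog_poly (alpha : multidegree) (p : S) : Prop :=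
  forall a, a \in msupp p -> mdegZ a = alpha.

Lemma homog_polyD alpha p p' :
  homog_poly alpha p -> homog_poly alpha p' -> homog_poly alpha (p + p').
Proof.
move=> hp hp' a /msuppD_le; rewrite mem_cat => /orP[]; [exact: hp|exact: hp'].
Qed.

Lemma homog_polyX alpha p b :
  homog_poly alpha p -> homog_poly (alpha + mdegZ b) ('X_[b] * p).
Proof.
move=> hp a /msuppM_le /allpairsP[[m1 m2] /= [h1 h2 ->]].
rewrite -(hp _ h2); move: h1; rewrite msuppX inE => /eqP ->.
by apply/ffunP => j; rewrite !ffunE mnmDE PoszD addrC.
Qed.

Lemma homog_polyC alpha p (c : k) :
  homog_poly alpha p -> homog_poly alpha (c%:MP * p).
Proof. by move=> hp a; rewrite mul_mpolyC => /msuppZ_le; apply: hp. Qed.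

Lemma homog_poly0 alpha : homog_poly alpha 0.
Proof. by move=> a; rewrite msupp0. Qed.

(* The multidegree of [p / x^a] is [deg p - a] *)
Definition homog_loc Gam (T : {set 'I_n}) (alpha : multidegree)
    (x : locT (SR Gam) T) : Prop :=
  exists (p : S) (w : denom (monomials_in T)) (a : 'X_{1..n}),
    [/\ sval w = 'X_[a], homog_poly (alpha + mdegZ a) p &
        x = mkfrac (quotpi (SR_ideal Gam) (p : S^o)) w].

Definition homog_cochain Gam (alpha : multidegree) (c : cochains (SR Gam)) :
    Prop :=
  forall T, homog_loc alpha (c T).

Lemma homog_cochain0 Gam alpha : homog_cochain alpha (0 : cochains (SR Gam)).
Proof.
move=> T; exists 0, (denom1 _), 0%MM; split; rewrite ?mpolyX0 ?linear0 //.
exact: homog_poly0.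
Qed.

Lemma homog_cochainP Gam alpha (a : k) (c c' : cochains (SR Gam)) :
  homog_cochain alpha c -> homog_cochain alpha c' ->
  homog_cochain alpha (a%:MP *: c + c').
Proof.
move=> hc hc' T.
have [p [w [b [ew hp ex]]]] := hc T; have [p' [w' [b' [ew' hp' ex']]]] := hc' T.
exists ('X_[b'] * (a%:MP * p) + 'X_[b] * p'), (denomM w w'), (b + b')%MM; split.
- by rewrite /= ew ew' mpolyXD.
- have -> : mdegZ (b + b')%MM = mdegZ b + mdegZ b'.
    by apply/ffunP => j; rewrite !ffunE mnmDE PoszD.
  apply: homog_polyD; first by rewrite addrA; apply/homog_polyX/homog_polyC.
  by rewrite [mdegZ b + _]addrC addrA; apply: homog_polyX.
rewrite -[LHS]/(a%:MP *: c T + c' T) ex ex' mkfracZ mkfracD ew ew'.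
have E (s : S) (r : S^o) :
  s *: quotpi (SR_ideal Gam) r = quotpi (SR_ideal Gam) (s * r : S^o).
  by rewrite -(linearZ_LR (quotpi (SR_ideal Gam))).
rewrite (E a%:MP p) (E 'X_[b'] (a%:MP * p)) (E 'X_[b] p').
by rewrite -(linearD (quotpi (SR_ideal Gam))).
Qed.

Section GradedPiece.
Variables (Gam : {set {set 'I_n}}) (A : {set 'I_n}) (q : nat).
Variable alpha : multidegree.
Local Notation H := (local_cohomology (SR Gam) A q).

Definition homog_class : {pred restr H} := fun h =>
  `[< exists2 z : submod (cocycles A q), homog_cochain alpha (submod_val z) &
        h = quotpi (coboundaries A q) z >].

Fact homog_class_closed : subsemimod_closed homog_class.
Proof.
apply: GRing.submod_closed_semi; split.
  apply/asboolP; exists 0; last by rewrite linear0.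
  exact: homog_cochain0.
move=> a u v /asboolP[z hz ->] /asboolP[z' hz' ->]; apply/asboolP.
exists (a%:MP *: z + z'); first exact: homog_cochainP.
by rewrite [RHS]linearP.
Qed.

HB.instance Definition _ :=
  GRing.isSubmodClosed.Build k (restr H) homog_class homog_class_closed.

(* [H^q_p(k[Gam])_alpha] for [p = (x_j : j \in A)], as a vector space *)
Definition graded_piece : lmodType k := submod homog_class.

End GradedPiece.

Arguments homog_class Gam A q alpha h : clear implicits.

Section GradedPieceMap.
Variables (Gam Gam' : {set {set 'I_n}}) (sG : Gam' \subset Gam).
Variables (A : {set 'I_n}) (q : nat) (alpha : multidegree).

Lemma homog_cochain_map (c : cochains (SR Gam)) :
  homog_cochain alpha c -> homog_cochain alpha (cech_map (SR_surj sG) c).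
Proof.
move=> hc T; have [p [w [a [ew hp ex]]]] := hc T; exists p, w, a; split=> //.
by rewrite -[LHS]/(locT_map _ T (c T)) ex [LHS]loc_map_frac SR_surj_pi.
Qed.

Lemma homog_class_map : {in homog_class Gam A q alpha, forall h,
  restr_map (local_cohomology_map A (SR_surj sG) q) h
    \in homog_class Gam' A q alpha}.
Proof.
move=> h /asboolP[z hz ->]; apply/asboolP.
exists (cocycle_map A (SR_surj sG) q z); first exact: homog_cochain_map.
exact: local_cohomology_map_pi.
Qed.

Definition graded_piece_map :
    {linear graded_piece Gam A q alpha -> graded_piece Gam' A q alpha} :=
  submod_map homog_class_map.

End GradedPieceMap.

Lemma graded_piece_map_id Gam (sG : Gam \subset Gam) A q alpha
    (x : graded_piece Gam A q alpha) : graded_piece_map sG A q alpha x = x.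
Proof.
apply: submod_inj; apply: local_cohomology_map_id.
by elim/quotpi_ind => p; rewrite SR_surj_pi.
Qed.

Lemma graded_piece_map_comp Gam1 Gam2 Gam3 (s12 : Gam2 \subset Gam1)
    (s23 : Gam3 \subset Gam2) (s13 : Gam3 \subset Gam1) A q alpha
    (x : graded_piece Gam1 A q alpha) :
  graded_piece_map s23 A q alpha (graded_piece_map s12 A q alpha x) =
  graded_piece_map s13 A q alpha x.
Proof.
apply: submod_inj; apply: local_cohomology_map_comp.
by elim/quotpi_ind => p; rewrite !SR_surj_pi.
Qed.

End StanleyReisner.

Section Persistence.
Variables (k : fieldType) (R : realType).

Record pmod := PMod {
  pobj :> R -> lmodType k;
  pmap : forall s t : R, s <= t -> {linear pobj t -> pobj s};
  pmap_id : forall (t : R) (tt : t <= t) v, pmap tt v = v;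
  pmap_comp : forall (r s t : R) (rs : r <= s) (st : s <= t) (rt : r <= t) v,
    pmap rs (pmap st v) = pmap rt v
}.

Definition pmod_iso (V W : pmod) : Prop :=
  exists phi : forall t, {linear V t -> W t},
    (forall t, bijective (phi t)) /\
    (forall (s t : R) (st : s <= t) v,
       phi s (pmap V st v) = pmap W st (phi t v)).

Definition pmod_zero (V : pmod) : Prop := forall t (v : V t), v = 0.

Definition pointwise_fin_dim (V : pmod) : Prop :=
  forall t, exists d : nat, inhabited (Vector.axiom d (V t)).

Definition constructible (V : pmod) (C : set R) : Prop :=
  finite_set C /\
  forall (s t : R) (st : s <= t),
    ([set` `[s, t]] `&` C = set0)%classic -> bijective (pmap V st).

Definition finite_rank (V W : lmodType k) (phi : {linear V -> W}) : Prop :=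
  exists (d : nat) (b : 'I_d -> V),
    forall v, exists c : 'I_d -> k, phi v = \sum_l c l *: phi (b l).

Definition q_tame (V : pmod) : Prop :=
  forall (s t : R) (st : s <= t), s < t -> finite_rank (pmap V st).

Section DirectSum.
Variables (N : nat) (V : 'I_N -> pmod).

Definition psum_obj (t : R) : lmodType k := dprod (fun l => V l t : lmodType k).

Definition psum_map (s t : R) (st : s <= t) : {linear psum_obj t -> psum_obj s} :=
  dprod_map (fun l => pmap (V l) st).

Fact psum_map_id (t : R) (tt : t <= t) v : psum_map tt v = v.
Proof. by apply: funext_dep => l; apply: pmap_id. Qed.

Fact psum_map_comp (r s t : R) (rs : r <= s) (st : s <= t) (rt : r <= t) v :
  psum_map rs (psum_map st v) = psum_map rt v.
Proof. by apply: funext_dep => l; apply: pmap_comp. Qed.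

Definition psum : pmod := PMod psum_map_id psum_map_comp.

End DirectSum.

(* Intervals are nonempty, as needed for the uniqueness of decompositions *)
Record rinterval := RInterval {
  rint :> set R;
  rintP : is_interval rint;
  rint_neq0 : (rint !=set0)%classic
}.

Section IntervalModule.
Variable J : rinterval.

(* ['rV_b], [b : bool], is [k] when [b] is true and [0] otherwise; the 1 x 1
   matrix [const_mx 1] is the identity *)
Definition interval_obj (t : R) : lmodType k := 'rV[k]_(t \in (J : set R)).

Definition interval_map (s t : R) (st : s <= t) :
    {linear interval_obj t -> interval_obj s} :=
  mulmxr (const_mx 1 : 'M[k]_(t \in (J : set R), s \in (J : set R))).

Fact interval_map_id (t : R) (tt : t <= t) v : interval_map tt v = v.
Proof.
rewrite /interval_map /=; move: v; rewrite /interval_obj.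
case: (t \in _) => v /=; last by rewrite [v]thinmx0 mul0mx.
rewrite (_ : const_mx 1 = 1%:M) ?mulmx1 //.
by apply/matrixP => i j; rewrite !mxE !ord1.
Qed.

Fact interval_map_comp (r s t : R) (rs : r <= s) (st : s <= t) (rt : r <= t) v :
  interval_map rs (interval_map st v) = interval_map rt v.
Proof.
rewrite /interval_map /= -mulmxA; congr (_ *m _).
have : (t \in (J : set R)) -> (r \in (J : set R)) -> (s \in (J : set R)).
  by move=> /set_mem Jt /set_mem Jr; apply/mem_set/(rintP Jr Jt); rewrite rs st.
move: {v} (t \in _) (r \in _) (s \in _) => [] [] [] h;
  apply/matrixP => i j; rewrite ?mxE; try by [case: i|case: j|move: (h isT isT)].
by rewrite big_ord1 !mxE mulr1.
Qed.

Definition interval_pmod : pmod := PMod interval_map_id interval_map_comp.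

End IntervalModule.

Definition interval_decomposition (V : pmod) (N : nat) (J : 'I_N -> rinterval) :
    Prop :=
  pmod_iso V (psum (fun l => interval_pmod (J l))).

End Persistence.

Section LocalCohomologyPersistence.
Variables (k : fieldType) (R : realType) (n : nat).
Variables (Delta : {set {set 'I_n}}) (f : {set 'I_n} -> R).

(* Only the values of [f] on the faces of [Delta] matter *)
Definition monotonic : Prop :=
  forall tau sigma, tau \in Delta -> sigma \in Delta ->
    tau \subset sigma -> f tau <= f sigma.

Definition sublevel (t : R) : {set {set 'I_n}} :=
  [set sigma in Delta | f sigma <= t].

Definition Crit : set R :=
  [set t | exists2 tau, tau \in Delta & f tau = t]%classic.

Lemma sublevelS (s t : R) : s <= t -> sublevel s \subset sublevel t.
Proof.
move=> st; apply/fintype.subsetP => sigma; rewrite !inE => /andP[-> h] /=.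
exact: le_trans h st.
Qed.

Definition deletion (i : 'I_n) : {set {set 'I_n}} :=
  [set tau in Delta | i \notin tau].

Definition link (i : 'I_n) : {set {set 'I_n}} :=
  [set tau : {set 'I_n} | (i \notin tau) && (i |: tau \in Delta)].

Section Module.
Variables (i : 'I_n) (q : nat) (alpha : multidegree n).

Definition local_obj (t : R) : lmodType k :=
  graded_piece k (sublevel t) [set~ i] q alpha.

Definition local_map (s t : R) (st : s <= t) :
    {linear local_obj t -> local_obj s} :=
  graded_piece_map k (sublevelS st) [set~ i] q alpha.

Fact local_map_id (t : R) (tt : t <= t) v : local_map tt v = v.
Proof. exact: graded_piece_map_id. Qed.

Fact local_map_comp (r s t : R) (rs : r <= s) (st : s <= t) (rt : r <= t) v :
  local_map rs (local_map st v) = local_map rt v.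
Proof. exact: graded_piece_map_comp. Qed.

Definition local_pmod : pmod k R := PMod local_map_id local_map_comp.

End Module.

End LocalCohomologyPersistence.

(* [(c; -1_sigma)] *)
Definition face_degree (n : nat) (i : 'I_n) (c : int) (sigma : {set 'I_n}) :
    multidegree n :=
  [ffun j => if j == i then c else - (j \in sigma)%:Z].

(* Main.v *)
Require Import Defs.
From HB Require Import structures.
From mathcomp Require Import all_boot all_order all_algebra fingroup perm.
From mathcomp Require Import boolp classical_sets cardinality reals.
From mathcomp Require Import num_normedtype(is_interval).
From mathcomp Require Import generic_quotient mpoly ring.

(* In degree [alpha], with [N] and [P] the sets where [alpha] is negative and
   positive, the Cech complex of [k[Gam]] on the variables in [A] has a copy of
   [k] at each [T] between [N] and [A] such that [T :|: P \in Gam], and zero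
   elsewhere. Hence multiplying by a Laurent monomial identifies the complexes
   of all degrees with the same [N] and [P], naturally in [Gam]. If [P] meets
   [A], adding a vertex of [P] to [T] is a contracting homotopy; if [N] is not
   a subset of [A], or no [T] qualifies, the complex is zero. The remaining
   pairs are [P = set0] and [P = [set i]], which are the face degrees.

   The module only depends on [t] through the sublevel complex, so it is pulled
   back from a representation of a finite linear quiver. Such a representation
   splits off an interval: with [lo] minimal such that [V lo != 0] and [hi]
   maximal such that [V hi -> V lo] is nonzero, a vector of [V hi] and a form on
   [V lo] which do not pair to zero span a direct summand [k_[lo, hi]].
   Uniqueness holds because the ranks of the structure maps count the intervals
   containing two given points. *)

Set Implicit Arguments.
Unset Strict Implicit.
Unset Printing Implicit Defensive.
Import Order.TTheory GRing.Theory Num.Theory.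
Local Open Scope ring_scope.
Local Open Scope quotient_scope.

(** * Finite-dimensional spaces *)

Section Dimension.
Variable k : fieldType.
Implicit Types V : lmodType k.

Definition indep V (d : nat) (b : 'I_d -> V) : Prop :=
  forall c : 'I_d -> k, \sum_l c l *: b l = 0 -> forall l, c l = 0.

(** Bounding independent families, rather than giving a basis, makes the bound pass to kernels at
    once. *)
Definition dim_le V (m : nat) : Prop :=
  forall (d : nat) (b : 'I_d -> V), indep b -> (d <= m)%N.

Definition ord_cons (T : Type) (d : nat) (x : T) (b : 'I_d -> T) : 'I_d.+1 -> T :=
  fun l => if unlift ord0 l is Some l' then b l' else x.

Lemma ord_cons0 T d (x : T) (b : 'I_d -> T) : ord_cons x b ord0 = x.
Proof. by rewrite /ord_cons unlift_none. Qed.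

Lemma ord_consS T d (x : T) (b : 'I_d -> T) l : ord_cons x b (lift ord0 l) = b l.
Proof. by rewrite /ord_cons liftK. Qed.

(** An independent family of maximal length spans: a vector outside its span could be put in front
    of it. *)
Lemma dim_le_basis V m : dim_le V m ->
  exists (d : nat) (b : 'I_d -> V),
    indep b /\ forall v, exists c : 'I_d -> k, v = \sum_l c l *: b l.
Proof.
move=> hV; pose P d := `[< exists b : 'I_d -> V, indep b >].
have P0 : exists d, P d.
  by exists 0%N; apply/asboolP; exists (fun=> 0) => c _ [].
have Pm d : P d -> (d <= m)%N by case/asboolP => b; apply: hV.
case: (ex_maxnP P0 Pm) => d /asboolP[b hb] dmax; exists d, b; split=> // v.
apply: contrapT => nv; suff /dmax : P d.+1 by rewrite ltnn.
apply/asboolP; exists (ord_cons v b) => c.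
rewrite big_ord_recl ord_cons0; under eq_bigr => l _ do rewrite ord_consS.
move=> e; have c0 : c ord0 = 0.
  apply: contrapT => /eqP c0; apply: nv.
  exists (fun l => - (c ord0)^-1 * c (lift ord0 l)).
  under eq_bigr => l _ do rewrite -scalerA.
  rewrite -scaler_sumr; move/eqP: e; rewrite addrC addr_eq0 => /eqP ->.
  by rewrite scalerN scaleNr opprK scalerA mulVf // scale1r.
move: e; rewrite c0 scale0r add0r => /hb h l.
by case: (unliftP ord0 l) => [l'|] ->; [apply: h|].
Qed.

(** Coordinates are picked by choice; independence makes them unique, which yields both linearity
    and the inverse. *)
Lemma basis_vector_axiom V d (b : 'I_d -> V) :
  indep b -> (forall v, exists c : 'I_d -> k, v = \sum_l c l *: b l) ->
  inhabited (Vector.axiom d V).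
Proof.
move=> hb /choice[c hc].
have cU v (c' : 'I_d -> k) : v = \sum_l c' l *: b l -> c v = c'.
  move=> e; apply/funext => l; apply/eqP; rewrite -subr_eq0; apply/eqP.
  move: l; apply: hb; under eq_bigr => l _ do rewrite scalerBl.
  by rewrite sumrB -hc -e subrr.
constructor; exists (fun v => \row_l c v l).
  move=> a u v; apply/rowP => l; rewrite !mxE.
  rewrite (cU _ (fun l => a * c u l + c v l)) //.
  under eq_bigr => j _ do rewrite scalerDl -scalerA.
  by rewrite big_split -scaler_sumr /= -!hc.
exists (fun u : 'rV_d => \sum_l u 0 l *: b l) => [v|u].
  by rewrite [RHS]hc; apply: eq_bigr => l _; rewrite mxE.
by apply/rowP => l; rewrite mxE (cU _ (u 0)).
Qed.

(** The form is a coordinate that does not vanish at [v], rescaled. *)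
Lemma dim_le_separated V m (v : V) : dim_le V m -> v != 0 ->
  exists xi : {linear V -> k^o}, xi v = 1.
Proof.
move=> /dim_le_basis[d [b [hb sb]]] v0.
have [[r rl rb]] := basis_vector_axiom hb sb.
pose rL : {linear V -> 'rV[k]_d} :=
  HB.pack_for {linear V -> 'rV[k]_d} r (GRing.isLinear.Build k V 'rV[k]_d _ r rl).
have [l nz] : exists l, r v 0 l != 0.
  apply: contrapT => h; move: v0; rewrite -(inj_eq (bij_inj rb)).
  have -> : r 0 = 0 by exact: (linear0 rL).
  case/eqP; apply/rowP => l; rewrite mxE; apply: contrapT => /eqP nz.
  by apply: h; exists l.
have xl : linear (fun u => (r v 0 l)^-1 * r u 0 l : k^o).
  by move=> a x y; rewrite rl !mxE mulrDr /GRing.scale /= mulrCA.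
exists (HB.pack_for {linear V -> k^o} (fun u => (r v 0 l)^-1 * r u 0 l : k^o)
  (GRing.isLinear.Build k V k^o _ _ xl)).
by rewrite /= mulVf.
Qed.

End Dimension.

(** * Representations of a linear quiver *)

Lemma submod_val_linear (A : nzRingType) (V : lmodType A) (N : submodClosed V) :
  linear (@submod_val A V N).
Proof. by []. Qed.

HB.instance Definition _ (A : nzRingType) (V : lmodType A) (N : submodClosed V) :=
  GRing.isLinear.Build A (submod N) V _ (@submod_val A V N)
    (@submod_val_linear A V N).

Section Kernel.
Variables (k : fieldType) (V W : lmodType k) (g : {linear V -> W}).

Definition kerp : {pred V} := fun v => g v == 0.

Fact kerp_closed : subsemimod_closed kerp.
Proof.
apply: GRing.submod_closed_semi; split=> [|a u v].
  by rewrite /in_mem /= /kerp linear0.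
by rewrite /in_mem /= /kerp linearP => /eqP-> /eqP->; rewrite scaler0 addr0.
Qed.

HB.instance Definition _ := GRing.isSubmodClosed.Build k V kerp kerp_closed.

Lemma kerpP v : reflect (g v = 0) (v \in kerp).
Proof. exact: eqP. Qed.

Lemma dim_le_kerp m : dim_le V m -> dim_le (submod kerp) m.
Proof.
move=> hV d b hb; apply: (hV d (fun l => submod_val (b l))) => c e.
by apply: hb; apply: submod_inj; rewrite -[RHS]e raddf_sum.
Qed.

(** An independent family of the kernel stays independent with [v] in front, because applying [g] to
    a relation isolates the coefficient of [v]. *)
Lemma dim_le_kerp_lt m v : g v != 0 -> dim_le V m -> dim_le (submod kerp) m.-1.
Proof.
move=> gv hV d b hb; suff h : (d.+1 <= m)%N by case: (m) h.
apply: (hV _ (ord_cons v (fun l => submod_val (b l)))) => c.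
rewrite big_ord_recl ord_cons0; under eq_bigr => l _ do rewrite ord_consS.
move=> e; have c0 : c ord0 = 0.
  have := congr1 g e; rewrite linearD linearZ_LR linear_sum big1 ?addr0 => [|l _].
    rewrite linear0 => /eqP; rewrite -[_ == _]/(_ *: _ == 0) scaler_eq0.
    by rewrite (negbTE gv) orbF => /eqP.
  by rewrite linearZ_LR (kerpP _ (submodP (b l))) scaler0.
move: e; rewrite c0 scale0r add0r => e l.
have {}hb := hb (fun l => c (lift ord0 l)).
case: (unliftP ord0 l) => [l'|] -> //; apply: hb.
by apply: submod_inj; rewrite -[RHS]e raddf_sum.
Qed.

End Kernel.

Section Chain.
Variables (k : fieldType) (m : nat).

(** All composites of arrows are part of the data, in the shape of [pmod], so that the two kinds of
    modules can be compared map by map. *)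
Record chain_mod := ChainMod {
  cobj :> 'I_m -> lmodType k;
  cmap : forall i j : 'I_m, (i <= j)%N -> {linear cobj j -> cobj i};
  cmap_id : forall (i : 'I_m) (ii : (i <= i)%N) v, cmap ii v = v;
  cmap_comp : forall (h i j : 'I_m) (hi : (h <= i)%N) (ij : (i <= j)%N)
    (hj : (h <= j)%N) v, cmap hi (cmap ij v) = cmap hj v
}.

Definition between (lo hi j : 'I_m) : bool := (lo <= j <= hi)%N.

(** Dual bases compatible with the maps, in place of an isomorphism with a direct sum. Vectors and
    forms exist at every index and vanish off their interval, so no type depends on an interval;
    below [cd_lo], [cd_map] says that the vector dies. *)
Record chain_decomposition (V : chain_mod) (N : nat) := ChainDecomposition {
  cd_lo : 'I_N -> 'I_m;
  cd_hi : 'I_N -> 'I_m;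
  cd_coord : forall (l : 'I_N) (j : 'I_m), {linear V j -> k^o};
  cd_basis : 'I_N -> forall j : 'I_m, V j;
  cd_basis0 : forall l j, ~~ between (cd_lo l) (cd_hi l) j -> cd_basis l j = 0;
  cd_coordE : forall l l' j, cd_coord l j (cd_basis l' j) =
    ((l == l') && between (cd_lo l) (cd_hi l) j)%:R;
  cd_coord0 : forall l j v, ~~ between (cd_lo l) (cd_hi l) j -> cd_coord l j v = 0;
  cd_sum : forall j v, v = \sum_l cd_coord l j v *: cd_basis l j;
  cd_map : forall (l : 'I_N) (i j : 'I_m) (ij : (i <= j)%N),
    between (cd_lo l) (cd_hi l) j -> cmap V ij (cd_basis l j) = cd_basis l i
}.

Lemma chain_zero_decomposition (V : chain_mod) :
  (forall j (v : V j), v = 0) -> inhabited (chain_decomposition V 0).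
Proof.
(* ['I_m] may be empty, so the empty families are built by [False_rect] and not from a default
   index. *)
move=> V0; have no (l : 'I_0) : False by case: l.
constructor; exists (fun l => False_rect _ (no l)) (fun l => False_rect _ (no l))
  (fun l _ => False_rect _ (no l)) (fun l _ => False_rect _ (no l));
  try by move=> l; case: (no l).
by move=> j v; rewrite big_ord0; apply: V0.
Qed.

Section Split.
Variable V : chain_mod.
Variables (lo hi : 'I_m) (xi : forall j, {linear V j -> k^o}) (e : forall j, V j).
Hypothesis e0 : forall j, ~~ between lo hi j -> e j = 0.
Hypothesis xi0 : forall j v, ~~ between lo hi j -> xi j v = 0.
Hypothesis xie : forall j, between lo hi j -> xi j (e j) = 1.
Hypothesis e_map : forall (i j : 'I_m) (ij : (i <= j)%N),
  between lo hi j -> cmap V ij (e j) = e i.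
Hypothesis xi_map : forall (i j : 'I_m) (ij : (i <= j)%N) v,
  xi j v = 0 -> xi i (cmap V ij v) = 0.

(** The common kernel of the forms is a complement to the span of the [e j], and [xi_map] makes it a
    subrepresentation. *)
Definition complement_obj (j : 'I_m) : lmodType k := submod (kerp (xi j)).

Lemma complement_stable (i j : 'I_m) (ij : (i <= j)%N) :
  {in kerp (xi j), forall v, cmap V ij v \in kerp (xi i)}.
Proof. by move=> v /kerpP h; apply/kerpP/xi_map. Qed.

Definition complement_map (i j : 'I_m) (ij : (i <= j)%N) :
    {linear complement_obj j -> complement_obj i} :=
  submod_map (complement_stable ij).

Fact complement_id (i : 'I_m) (ii : (i <= i)%N) v : complement_map ii v = v.
Proof. by apply: submod_inj; apply: cmap_id. Qed.

Fact complement_comp (h i j : 'I_m) (le_hi : (h <= i)%N) (le_ij : (i <= j)%N)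
    (le_hj : (h <= j)%N) v :
  complement_map le_hi (complement_map le_ij v) = complement_map le_hj v.
Proof. by apply: submod_inj; apply: cmap_comp. Qed.

Definition complement : chain_mod := ChainMod complement_id complement_comp.

Lemma xi_e j : xi j (e j) = (between lo hi j)%:R.
Proof. by case: (boolP (between lo hi j)) => [/xie->|/xi0->]. Qed.

Fact proj_subproof j (v : V j) : v - xi j v *: e j \in kerp (xi j).
Proof.
apply/kerpP; rewrite linearB linearZ_LR /= xi_e /GRing.scale /=.
case: (boolP (between lo hi j)) => [_|/xi0->]; first by rewrite mulr1 subrr.
by rewrite mul0r subrr.
Qed.

Definition proj j (v : V j) : complement j := Submod (proj_subproof v).

Lemma proj_linear j : linear (@proj j).
Proof.
move=> a u v; apply: submod_inj; rewrite /= !linearP /=.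
by rewrite scalerDl scalerBr scalerA addrACA opprD.
Qed.

HB.instance Definition _ j :=
  GRing.isLinear.Build k (V j) (complement j) _ (@proj j) (@proj_linear j).

Lemma proj_val j (u : complement j) : proj (submod_val u) = u.
Proof. by apply: submod_inj; rewrite /= (kerpP _ _ (submodP u)) scale0r subr0. Qed.

Lemma proj_e j : proj (e j) = 0.
Proof.
apply: submod_inj => /=; rewrite xi_e.
case: (boolP (between lo hi j)) => [_|/e0->]; first by rewrite scale1r subrr.
by rewrite scaler0 subrr.
Qed.

(** The split summand takes index [ord0]; forms on the complement extend to [V] by precomposition
    with the projection along [e]. *)
Lemma complement_decomposition N :
  chain_decomposition complement N -> inhabited (chain_decomposition V N.+1).
Proof.
case=> lo' hi' x' e' e'0 x'e' x'0 sum' map'.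
pose X (l : 'I_N.+1) (j : 'I_m) : {linear V j -> k^o} :=
  if unlift ord0 l is Some l' then x' l' j \o @proj j else xi j.
pose E (l : 'I_N.+1) (j : 'I_m) : V j :=
  if unlift ord0 l is Some l' then submod_val (e' l' j) else e j.
constructor; exists (ord_cons lo lo') (ord_cons hi hi') X E.
- move=> l j; rewrite /E; case: (unliftP ord0 l) => [l'|] ->.
    by rewrite !ord_consS => h; rewrite e'0.
  by rewrite !ord_cons0; apply: e0.
- move=> l l' j; rewrite /X /E; case: (unliftP ord0 l) => [p|] ->;
    case: (unliftP ord0 l') => [p'|] ->; rewrite ?ord_consS ?ord_cons0 /=.
  + by rewrite proj_val x'e' (inj_eq (lift_inj (h := ord0))).
  + by rewrite proj_e linear0.
  + by rewrite (kerpP _ _ (submodP (e' p' j))).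
  + by rewrite xi_e.
- move=> l j v; rewrite /X; case: (unliftP ord0 l) => [l'|] ->.
    by rewrite !ord_consS /= => h; rewrite x'0.
  by rewrite !ord_cons0; apply: xi0.
- move=> j v; rewrite big_ord_recl {1}/X {1}/E unlift_none.
  under eq_bigr => l _ do rewrite /X /E liftK /=.
  have := congr1 (@submod_val _ _ _) (sum' j (proj v)).
  by rewrite raddf_sum /= => /(canRL (subrK _)) h; rewrite [LHS]h addrC.
- move=> l i j ij; rewrite /E; case: (unliftP ord0 l) => [l'|] ->.
    by rewrite !ord_consS => h; rewrite -(map' _ _ _ ij).
  by rewrite !ord_cons0; apply: e_map.
Qed.

End Split.

(** Induction on the sum of the bounds, which splitting off an interval lowers at [lo]. *)
Lemma chain_decomposable (V : chain_mod) (d : 'I_m -> nat) :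
  (forall j, dim_le (V j) (d j)) -> exists N, inhabited (chain_decomposition V N).
Proof.
have [n] := ubnP (\sum_j d j)%N; elim: n V d => // n IHn V d dn hd.
have [V0|] := pselect (forall j (v : V j), v = 0).
  by exists 0%N; apply: chain_zero_decomposition.
move=> /existsNP[j0 /existsNP[v0 /eqP nz0]].
pose P (j : 'I_m) := `[< exists v : V j, v != 0 >].
have Pj0 : P j0 by apply/asboolP; exists v0.
case: (arg_minnP (@nat_of_ord m) Pj0) => lo /asboolP[w w0] lomin.
pose Q (j : 'I_m) := `[< exists h : (lo <= j)%N, exists v, cmap V h v != 0 >].
have Qlo : Q lo by apply/asboolP; exists (leqnn _), w; rewrite cmap_id.
case: (arg_maxnP (@nat_of_ord m) Qlo) => hi /asboolP[lohi [v vnz]] himax.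
have [x xv] := dim_le_separated (hd lo) vnz.
(* The form [x] on [V lo] is pulled back to all indices above [lo], and [v] is pushed down to all
   indices below [hi]; [pselect] supplies the inequality that [cmap] takes as an argument. *)
pose xi j : {linear V j -> k^o} :=
  if pselect (lo <= j)%N is left h then x \o cmap V h else \0.
pose e j : V j := if pselect (j <= hi)%N is left h then cmap V h v else 0.
have xiE (j : 'I_m) (h : (lo <= j)%N) u : xi j u = x (cmap V h u).
  by rewrite /xi; case: pselect => // h'; rewrite (bool_irrelevance h' h).
have xiN (j : 'I_m) u : ~~ (lo <= j)%N -> xi j u = 0.
  by move=> /negP h; rewrite /xi; case: pselect.
have eE (j : 'I_m) (h : (j <= hi)%N) : e j = cmap V h v.
  by rewrite /e; case: pselect => // h'; rewrite (bool_irrelevance h' h).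
have eN (j : 'I_m) : ~~ (j <= hi)%N -> e j = 0.
  by move=> /negP h; rewrite /e; case: pselect.
(* Minimality of [lo] makes [e] vanish below [lo], and maximality of [hi] makes [xi] vanish above
   [hi]. *)
have lo0 (j : 'I_m) (u : V j) : ~~ (lo <= j)%N -> u = 0.
  move=> h; apply: contrapT => /eqP unz; case/negP: h; apply: lomin.
  by apply/asboolP; exists u.
have hi0 (j : 'I_m) (h : (lo <= j)%N) u : ~~ (j <= hi)%N -> cmap V h u = 0.
  move=> g; apply: contrapT => /eqP unz; case/negP: g; apply: himax.
  by apply/asboolP; exists h, u.
have e0 (j : 'I_m) : ~~ between lo hi j -> e j = 0.
  by rewrite negb_and => /orP[h|/eN//]; apply: lo0 h.
have xi0 (j : 'I_m) u : ~~ between lo hi j -> xi j u = 0.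
  rewrite negb_and => /orP[/xiN->//|h].
  case: (boolP (lo <= j)%N) => [g|/xiN//].
  by rewrite (xiE _ g) /= hi0 // linear0.
have xie (j : 'I_m) : between lo hi j -> xi j (e j) = 1.
  by case/andP => h1 h2; rewrite (xiE _ h1) (eE _ h2) (cmap_comp _ _ lohi).
have e_map (i j : 'I_m) (ij : (i <= j)%N) : between lo hi j -> cmap V ij (e j) = e i.
  case/andP => _ h; rewrite (eE _ h) (eE _ (leq_trans ij h)); exact: cmap_comp.
have xi_map (i j : 'I_m) (ij : (i <= j)%N) u : xi j u = 0 -> xi i (cmap V ij u) = 0.
  case: (boolP (lo <= i)%N) => [h|/xiN->//].
  by rewrite (xiE _ h) (xiE _ (leq_trans h ij)) (cmap_comp _ _ (leq_trans h ij)).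
pose d' j := if j == lo then (d j).-1 else d j.
have xinz : xi lo (e lo) != 0 by rewrite xie ?oner_neq0 // /between leqnn.
have [||N [D]] := IHn (complement xi_map) d'.
(* The predecessor in [d'] lowers the sum only if [d lo] is positive; the nonzero vector [e lo]
   ensures it. *)
- have dlo : (0 < d lo)%N.
    apply: (hd lo 1%N (fun=> e lo)) => c; rewrite big_ord1 => h l; rewrite (ord1 l).
    have := congr1 (xi lo) h; rewrite linearZ_LR linear0 => /eqP.
    by rewrite -[_ == _]/(_ *: _ == 0) scaler_eq0 (negbTE xinz) orbF => /eqP.
  move: dn; rewrite ltnS; apply: leq_trans.
  rewrite (bigD1 lo) //= [X in (_ <= X)%N](bigD1 lo) //=.
  rewrite /d' eqxx -addSn prednK //; apply: leq_add => //.
  by apply: leq_sum => j /negbTE ->.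
- move=> j; rewrite /d'; case: eqP => [->|_]; last exact: dim_le_kerp.
  exact: dim_le_kerp_lt xinz _.
by exists N.+1; apply: (complement_decomposition e0 xi0 xie e_map D).
Qed.

End Chain.

(** * Interval decompositions *)

Section MaximalCancellation.
Variable T : Type.
Implicit Types (s : seq (set T)) (X Y : set T).
Local Open Scope classical_set_scope.

Definition above X : pred (set T) := fun Y => `[< X `<=` Y >].

Lemma exists_maximal s : s != [::] ->
  exists2 X, X \in s & forall Y, Y \in s -> X `<=` Y -> Y = X.
Proof.
elim: s => // X [|Z s] IHs _.
  by exists X => [|Y]; rewrite inE //= => /eqP.
have [//|M Ms Mmax] := IHs.
have [MX|nMX] := pselect (M `<=` X /\ X <> M); last first.
  exists M; first by rewrite inE Ms orbT.
  move=> Y; rewrite inE => /orP[/eqP->|]; last exact: Mmax.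
  by move=> MX; apply: contrapT => XM; apply: nMX.
exists X => [|Y]; first by rewrite inE eqxx.
rewrite inE => /orP[/eqP //|Ys] XY.
have YM := Mmax _ Ys (subset_trans MX.1 XY); apply/seteqP; split=> //.
by rewrite YM; exact: MX.1.
Qed.

(* A maximal member [X] is only above itself, so that it occurs as often in
   both families; cancel it once and recurse *)
Lemma count_above_perm_eq s s' :
  (forall X, X \in s ++ s' -> count (above X) s = count (above X) s') ->
  perm_eq s s'.
Proof.
have [n] := ubnP (size (s ++ s')); elim: n s s' => // n IHn s s' sn hs.
have [e|] := eqVneq (s ++ s') [::]; first by case: s {sn hs} e => //= ->.
move=> /exists_maximal[X Xin Xmax].
have cX r : {subset r <= s ++ s'} -> count (above X) r = count_mem X r.
  move=> sr; apply: eq_in_count => Y /sr Yin /=.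
  by apply/asboolP/eqP => [|->//]; apply: Xmax.
have sl : {subset s <= s ++ s'} by move=> Y h; rewrite mem_cat h.
have sr : {subset s' <= s ++ s'} by move=> Y h; rewrite mem_cat h orbT.
have eX := hs _ Xin; rewrite !cX // in eX.
have Xs : X \in s.
  by move: Xin; rewrite mem_cat -!has_pred1 !has_count eX orbb.
have Xs' : X \in s' by rewrite -has_pred1 has_count -eX -has_count has_pred1.
have p := perm_to_rem Xs; have p' := perm_to_rem Xs'.
rewrite (permPl p) perm_sym (permPl p') perm_cons perm_sym.
apply: IHn => [|Y].
  move: sn; rewrite ltnS !size_cat (perm_size p) (perm_size p') /= => sn.
  by apply: leq_trans sn; rewrite addSn addnS ltnW.
rewrite mem_cat => hY; apply: (@addnI (above Y X)).
have cY r : (above Y X + count (above Y) r)%N = count (above Y) (X :: r) by [].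
(* With [X] put back in front, the counts are those over [s] and [s']. *)
rewrite !cY -(seq.permP p) -(seq.permP p'); apply: hs.
by rewrite mem_cat; case/orP: hY => /mem_rem ->; rewrite ?orbT.
Qed.

End MaximalCancellation.

Section PmodIso.
Variables (k : fieldType) (R : realType).
Implicit Types U V W : pmod k R.

Lemma pmod_iso_sym V W : pmod_iso V W -> pmod_iso W V.
Proof.
case=> phi [bphi nphi].
have inv t : {g : W t -> V t | cancel (phi t) g /\ cancel g (phi t)}.
  by apply: cid; case: (bphi t) => g; exists g.
have ginv t : linear (sval (inv t)).
  move=> a u v; case: (inv t) => g /= [c1 c2]; apply: (can_inj c1).
  by rewrite linearP !c2.
exists (fun t => HB.pack_for {linear W t -> V t} (sval (inv t))
  (GRing.isLinear.Build k (W t) (V t) _ _ (ginv t))).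
split=> [t|s t st w] /=; first by case: (inv t) => g /= []; exists (phi t).
case: (inv s) (inv t) => g [c1 c2] [g' [c1' c2']] /=; apply: (can_inj c1).
by rewrite c2 nphi c2'.
Qed.

Lemma pmod_iso_trans U V W : pmod_iso U V -> pmod_iso V W -> pmod_iso U W.
Proof.
move=> [phi [bphi nphi]] [psi [bpsi npsi]]; exists (fun t => psi t \o phi t).
split=> [t|s t st v] /=; first exact: (bij_comp (bpsi t) (bphi t)).
by rewrite nphi npsi.
Qed.

End PmodIso.

(** * Uniqueness of interval decompositions *)

Section Uniqueness.
Variables (k : fieldType) (R : realType).
Local Open Scope classical_set_scope.

Definition both (J : rinterval R) (s t : R) : bool :=
  (s \in (J : set R)) && (t \in (J : set R)).

Section Coordinates.
Variables (N : nat) (J : 'I_N -> rinterval R).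
Local Notation M := (psum (fun l => interval_pmod k (J l))).

(** A component is a row of length 0 or 1, so summing its entries gives a scalar, zero outside the
    interval. This embeds the spaces at all [t] into one space. *)
Definition psum_coord (t : R) (w : M t) : 'rV[k]_N :=
  \row_l (\sum_p (w l : 'rV_(t \in (J l : set R))) 0 p).

Definition psum_vec (t : R) (u : 'rV[k]_N) : M t :=
  fun l => const_mx (u 0 l) : 'rV_(t \in (J l : set R)).

Lemma psum_coord_linear t : linear (@psum_coord t).
Proof.
move=> a u v; apply/rowP => l; rewrite !mxE mulr_sumr -big_split.
by apply: eq_bigr => p _; rewrite -[(a *: u + v) l]/(a *: u l + v l) !mxE.
Qed.

HB.instance Definition _ t :=
  GRing.isLinear.Build k (M t) 'rV[k]_N _ (@psum_coord t) (@psum_coord_linear t).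

Lemma psum_vec_linear t : linear (@psum_vec t).
Proof.
move=> a u v; apply: functional_extensionality_dep => l; apply/rowP => p.
by rewrite -[RHS]/((a *: psum_vec t u l + psum_vec t v l) 0 p) !mxE.
Qed.

HB.instance Definition _ t :=
  GRing.isLinear.Build k 'rV[k]_N (M t) _ (@psum_vec t) (@psum_vec_linear t).

Lemma psum_coordK t (w : M t) : psum_vec t (psum_coord w) = w.
Proof.
apply: functional_extensionality_dep => l; apply/rowP => p; rewrite !mxE.
move: (w l) p; rewrite /= /interval_obj; case: (t \in _) => w' p; last by case: p.
by rewrite big_ord1 (ord1 p).
Qed.

(** Structure maps become diagonal 0-1 matrices, whose rank counts the intervals through both
    points. *)
Lemma psum_coord_map (s t : R) (st : s <= t) (u : 'rV_N) l :
  psum_coord (Defs.pmap M st (psum_vec t u)) 0 l = u 0 l * (both (J l) s t)%:R.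
Proof.
rewrite mxE /= /psum_map /dprod_map /= /interval_map /both /psum_vec /=.
under eq_bigr => p _ do rewrite mxE.
case: (s \in _) => /=; last by rewrite big_ord0 mulr0.
rewrite big_ord1; case: (t \in _); last by rewrite big_ord0 mulr0.
by rewrite big_ord1 !mxE !mulr1.
Qed.

Lemma psum_coord_vec t (u : 'rV_N) l :
  psum_coord (psum_vec t u) 0 l = u 0 l * (t \in (J l : set R))%:R.
Proof.
by rewrite -[psum_vec t u](pmap_id (lexx t)) psum_coord_map /both andbb.
Qed.

Lemma psum_coord_inj t : injective (@psum_coord t).
Proof. exact: can_inj (@psum_coordK t). Qed.

End Coordinates.

(** A comparison of ranks: the vectors supported on the summands in [A] map injectively to [M s],
    then by [psi] into the image of the structure map of [M'], where the coordinates in [A']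
    determine them. *)
Lemma psum_iso_count N N' (J : 'I_N -> rinterval R) (J' : 'I_N' -> rinterval R)
    (s t : R) : s <= t ->
  pmod_iso (psum (fun l => interval_pmod k (J l)))
           (psum (fun l => interval_pmod k (J' l))) ->
  (#|[set l | both (J l) s t]%SET| <= #|[set l | both (J' l) s t]%SET|)%N.
Proof.
set M := psum _; set M' := psum _ => st [psi [bpsi npsi]].
set A := [set l | _]%SET; set A' := [set l | _]%SET.
pose ext (u : 'rV[k]_#|A|) : 'rV[k]_N :=
  u *m \matrix_(p, l) (enum_val p == l)%:R.
have extE u p : ext u 0 (enum_val p) = u 0 p.
  rewrite mxE (bigD1 p) //= big1 ?addr0 => [|p' pp']; rewrite mxE ?eqxx ?mulr1 //.
  by rewrite (inj_eq enum_val_inj) (negbTE pp') mulr0.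
pose L : {linear 'rV[k]_#|A| -> 'rV[k]_N'} := @psum_coord _ J' s \o psi s \o
  Defs.pmap M st \o psum_vec J t \o mulmxr (\matrix_(p, l) (enum_val p == l)%:R).
have LE u : L u = psum_coord (psi s (Defs.pmap M st (psum_vec J t (ext u)))) by [].
pose F (u : 'rV[k]_#|A|) : 'rV[k]_#|A'| := \row_p L u 0 (enum_val p).
have FE u p : F u 0 p = L u 0 (enum_val p) by rewrite mxE.
have F_linear : linear F.
  move=> a u v; apply/rowP => p; rewrite [RHS]mxE [X in _ = X + _]mxE.
  by rewrite !FE linearP mxE [X in X + _]mxE.
pose FL := HB.pack_for {linear 'rV[k]_#|A| -> 'rV[k]_#|A'|} F
  (GRing.isLinear.Build k _ _ _ F F_linear).
suff : row_free (lin1_mx FL).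
  by rewrite -row_leq_rank => /leq_trans; apply; apply: rank_leq_col.
apply: inj_row_free => u; rewrite mul_rV_lin1 => Fu.
have z : psum_coord (psi s (Defs.pmap M st (psum_vec J t (ext u)))) = 0.
  apply/rowP => l; rewrite [RHS]mxE; case: (boolP (l \in A')) => [lA'|].
    have := congr1 (fun w : 'rV_#|A'| => w 0 (enum_rank_in lA' l)) Fu.
    by rewrite mxE LE enum_rankK_in // => ->; rewrite mxE.
  (* By naturality the vector comes from [M' t], hence has no coordinate off [A']. *)
  rewrite npsi -[psi t _]psum_coordK psum_coord_map inE => /negbTE ->.
  by rewrite mulr0.
have {}z : Defs.pmap M st (psum_vec J t (ext u)) = 0.
  by apply: (bij_inj (bpsi s)); rewrite linear0 -[LHS]psum_coordK z linear0.
apply/rowP => p; have := congr1 (fun w => psum_coord w 0 (enum_val p)) z.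
rewrite psum_coord_map extE linear0 !mxE; have := enum_valP p; rewrite inE => ->.
by rewrite mulr1.
Qed.

(** For each member of [Fs] that does not contain [I], the segment from [s] to [t] is widened to
    reach a point of [I] missing from it. Containing [I] is thus tested on two points, which is what
    ranks can see. *)
Lemma interval_test_points (I : rinterval R) (Fs : seq (set R)) :
  (forall J, J \in Fs -> is_interval J) ->
  exists s t : R, [/\ s <= t, (I : set R) s, (I : set R) t &
    forall J, J \in Fs -> J s -> J t -> (I : set R) `<=` J].
Proof.
elim: Fs => [_|J Fs IH hF].
  by have [x Ix] := rint_neq0 I; exists x, x; split.
have [J' J'F|s [t [st Is It hst]]] := IH; first by apply: hF; rewrite inE J'F orbT.
have iJ : is_interval J by apply: hF; rewrite inE eqxx.
have [IJ|] := pselect ((I : set R) `<=` J).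
  by exists s, t; split=> // J'; rewrite inE => /orP[/eqP->|/hst].
move=> /existsNP[x /not_implyP[Ix nJx]].
exists (Order.min s x), (Order.max t x); split.
- by rewrite ge_min le_max st.
- by rewrite minElt; case: ifP.
- by rewrite maxElt; case: ifP.
move=> J'; rewrite inE => /orP[/eqP->|J'F] Js Jt.
  by case: nJx; apply: (iJ _ _ Js Jt); rewrite ge_min le_max lexx !orbT.
have iJ' : is_interval J' by apply: hF; rewrite inE J'F orbT.
apply: hst => //; apply: (iJ' _ _ Js Jt); rewrite ge_min le_max ?lexx ?st ?orbT //.
Qed.

(** Ranks at test points give, for every interval of either family, the same number of members above
    it in both; [count_above_perm_eq] then matches the families. *)
Lemma interval_decomposition_unique (V : pmod k R) N N'
    (J : 'I_N -> rinterval R) (J' : 'I_N' -> rinterval R) :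
  interval_decomposition V J -> interval_decomposition V J' ->
  exists h : 'I_N -> 'I_N', bijective h /\ forall l, J l = J' (h l) :> set R.
Proof.
move=> VJ VJ'; have JJ' := pmod_iso_trans (pmod_iso_sym VJ) VJ'.
pose r := [seq (J l : set R) | l : 'I_N]; pose r' := [seq (J' l : set R) | l : 'I_N'].
have rP (X : set R) : X \in r ++ r' -> exists I : rinterval R, X = I :> set R.
  by rewrite mem_cat => /orP[] /mapP[l _ ->]; [exists (J l)|exists (J' l)].
have perm_rr' : perm_eq r r'.
  apply: count_above_perm_eq => X /rP[I ->{X}].
  have [|s [t [st Is It hst]]] := @interval_test_points I (r ++ r').
    by move=> X /rP[I' ->]; apply: rintP.
  have cnt N1 (K : 'I_N1 -> rinterval R) :
      {subset [seq (K l : set R) | l : 'I_N1] <= r ++ r'} ->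
      count (above (I : set R)) [seq (K l : set R) | l : 'I_N1] =
      #|[set l | both (K l) s t]%SET|.
    move=> sK; rewrite -sum1_count big_map big_enum_cond -sum1_card.
    apply: eq_bigl => l; rewrite inE /both /=.
    apply/asboolP/andP => [IK|[/set_mem Ks /set_mem Kt]].
      by split; apply/mem_set/IK.
    by apply: hst => //; apply: sK; apply: map_f; rewrite mem_enum.
  rewrite !cnt.
  - by apply/eqP; rewrite eqn_leq !psum_iso_count //; exact: pmod_iso_sym.
  - by move=> X h; rewrite mem_cat h orbT.
  by move=> X h; rewrite mem_cat h.
have e : N = N' by have := perm_size perm_rr'; rewrite !size_image !card_ord.
move: @r @r' {rP} perm_rr'; case: _ / e J' {VJ' JJ'} => J' r r' perm_rr'.
have /tuple_permP[p ep] : perm_eq r (map_tuple (fun l => J' l : set R) (ord_tuple N)).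
  exact: perm_rr'.
exists p; split; first by exists (p^-1)%g; [exact: permK|exact: permKV].
move=> l; have := congr1 (fun q => nth set0 q l) ep.
rewrite (nth_map l) ?size_enum_ord // nth_ord_enum => ->.
by rewrite (nth_map l) ?size_enum_ord // nth_ord_enum tnth_map tnth_ord_tuple.
Qed.

End Uniqueness.

(** * From quiver representations to interval modules *)

Section ChainToInterval.
Variables (k : fieldType) (R : realType) (m : nat) (C : chain_mod k m).

(** The counterpart of [psum_coord_map]: after expanding [u] in the basis, only the term of index
    [l] survives. *)
Lemma cd_coord_map N (D : chain_decomposition C N) (i j : 'I_m)
    (ij : (i <= j)%N) l u :
  cd_coord D l i (cmap C ij u) = cd_coord D l j u *
    (between (cd_lo D l) (cd_hi D l) i && between (cd_lo D l) (cd_hi D l) j)%:R.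
Proof.
rewrite {1}[u](cd_sum D) linear_sum [LHS]linear_sum (bigD1 l) //= big1 => [|l' ll'].
  rewrite addr0 [cmap _ _ _]linearZ_LR [LHS]linearZ_LR.
  have [h|h] := boolP (between (cd_lo D l) (cd_hi D l) j).
    by rewrite cd_map // cd_coordE eqxx andbT.
  by rewrite cd_coord0 // scale0r mul0r.
rewrite [cmap _ _ _]linearZ_LR [LHS]linearZ_LR.
have [h|h] := boolP (between (cd_lo D l') (cd_hi D l') j).
  by rewrite cd_map // cd_coordE eq_sym (negbTE ll') scaler0.
by rewrite cd_coord0 // scale0r.
Qed.

Variables (V : pmod k R) (lev : R -> 'I_m).
Hypothesis lev_mono : forall s t : R, s <= t -> (lev s <= lev t)%N.
Variable phi : forall t, {linear V t -> C (lev t)}.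
Hypothesis phi_bij : forall t, bijective (phi t).
Hypothesis phi_nat : forall (s t : R) (st : s <= t) v,
  phi s (Defs.pmap V st v) = cmap C (lev_mono st) (phi t v).

Lemma chain_interval_decomposition N0 : chain_decomposition C N0 ->
  exists N (J : 'I_N -> rinterval R), interval_decomposition V J.
Proof.
move=> D; pose K l : set R := [set t | between (cd_lo D l) (cd_hi D l) (lev t)]%classic.
(* An interval of indices may contain no value of [lev]. Its preimage is not an [rinterval], and it
   contributes nothing at any [lev t], so it is dropped. *)
pose A : {set 'I_N0} := [set l | `[< (K l !=set0)%classic >]]%SET.
have iK l : is_interval (K l).
  move=> x y /andP[h1 _] /andP[_ h2] z /andP[xz zy].
  by apply/andP; split; [apply: leq_trans h1 _|apply: leq_trans h2]; apply: lev_mono.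
have nK (p : 'I_#|A|) : (K (enum_val p) !=set0)%classic.
  by have := enum_valP p; rewrite inE => /asboolP.
pose J p := RInterval (iK _) (nK p).
have JE p t : (t \in (J p : set R)) =
    between (cd_lo D (enum_val p)) (cd_hi D (enum_val p)) (lev t).
  by apply/idP/idP => [/set_mem|h]; last exact/mem_set.
exists #|A|, J; rewrite /interval_decomposition; set M := psum _.
pose g t (u : C (lev t)) : 'rV[k]_#|A| := \row_p cd_coord D (enum_val p) (lev t) u.
have g_lin t : linear (g t).
  by move=> a u v; apply/rowP => p; rewrite !mxE linearP.
pose G t : {linear C (lev t) -> M t} := psum_vec J t \o
  HB.pack_for {linear C (lev t) -> 'rV[k]_#|A|} (g t)
    (GRing.isLinear.Build k _ _ _ _ (g_lin t)).
have GE t u p : psum_coord (G t u) 0 p = cd_coord D (enum_val p) (lev t) u.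
  rewrite psum_coord_vec mxE JE.
  have [_|/cd_coord0->] := boolP (between (cd_lo D (enum_val p)) _ (lev t)).
    by rewrite mulr1.
  by rewrite mulr0.
pose H t (w : M t) : C (lev t) :=
  \sum_p psum_coord w 0 p *: cd_basis D (enum_val p) (lev t).
have GK t : cancel (G t) (H t).
  move=> u; rewrite /H; under eq_bigr => p _ do rewrite GE.
  rewrite [RHS](cd_sum D) [RHS](bigID (fun l => l \in A)) /=.
  rewrite [X in _ + X]big1 => [|l]; first by rewrite addr0 [RHS]big_enum_val.
  rewrite inE => /asboolP nl; rewrite [cd_basis _ _ _]cd_basis0 ?scaler0 //.
  by apply/negP => h; apply: nl; exists t.
have HK t : cancel (H t) (G t).
  move=> w; apply: psum_coord_inj; apply/rowP => p; rewrite GE /H linear_sum.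
  rewrite (bigD1 p) //= big1 ?addr0 => [|q qp]; last first.
    rewrite linearZ_LR cd_coordE (inj_eq enum_val_inj) eq_sym (negbTE qp).
    by rewrite scaler0.
  rewrite linearZ_LR cd_coordE eqxx -JE.
  by rewrite -[w in RHS]psum_coordK psum_coord_vec.
exists (fun t => G t \o phi t); split=> [t|s t st v].
  have bG : bijective (G t) by exists (H t); [apply: GK|apply: HK].
  exact: (bij_comp bG (phi_bij t)).
rewrite -[LHS]/(G s (phi s (Defs.pmap V st v))) phi_nat; apply: psum_coord_inj.
apply/rowP => p; rewrite GE cd_coord_map.
rewrite -[RHS]/(psum_coord (Defs.pmap M st (psum_vec J t (g t (phi t v)))) 0 p).
rewrite psum_coord_map mxE.
by rewrite /both !JE.
Qed.

End ChainToInterval.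

(** * Multigraded coefficients *)

Section Multidegree.
Variables (k : fieldType) (n : nat).
Local Notation S := {mpoly k[n]}.
Implicit Types (alpha gamma : multidegree n) (p : S).

Definition neg_supp alpha : {set 'I_n} := [set j | alpha j < 0].
Definition pos_supp alpha : {set 'I_n} := [set j | 0 < alpha j].

Definition mnm_abs gamma : 'X_{1..n} := [multinom `|gamma j|%N | j < n].

Lemma mnm_absK (a : 'X_{1..n}) : mnm_abs (mdegZ a) = a.
Proof. by apply/mnmP => j; rewrite mnmE ffunE. Qed.

Lemma mdegZD (a b : 'X_{1..n}) : mdegZ (a + b)%MM = mdegZ a + mdegZ b.
Proof. by apply/ffunP => j; rewrite !ffunE mnmDE PoszD. Qed.

(** The first factor gives coefficient zero when [gamma] has a negative entry, where [mnm_abs]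
    returns an unrelated monomial. *)
Definition zcoef gamma p : k :=
  (mdegZ (mnm_abs gamma) == gamma)%:R * p@_(mnm_abs gamma).

Lemma zcoef_mdegZ a p : zcoef (mdegZ a) p = p@_a.
Proof. by rewrite /zcoef mnm_absK eqxx mul1r. Qed.

Lemma zcoef_linear gamma : linear (zcoef gamma : S -> k^o).
Proof.
by move=> a p q; rewrite /zcoef linearP mulrDr; congr (_ + _); apply: mulrCA.
Qed.

HB.instance Definition _ gamma :=
  GRing.isLinear.Build k S k^o _ (zcoef gamma : S -> k^o) (zcoef_linear gamma).

Lemma zcoefC gamma c p : zcoef gamma (c%:MP * p) = c * zcoef gamma p.
Proof. by rewrite mul_mpolyC [LHS](linearZ_LR (zcoef gamma : {linear S -> k^o})). Qed.

Lemma zcoef_mono gamma m : zcoef gamma 'X_[m] = (mdegZ m == gamma)%:R.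
Proof.
rewrite /zcoef mcoeffX; have [<-|h] := eqVneq (mdegZ m) gamma.
  by rewrite mnm_absK !eqxx mulr1.
have [e|] := eqVneq (mdegZ (mnm_abs gamma)) gamma; last by rewrite mul0r.
have [em|_] := eqVneq m (mnm_abs gamma); last by rewrite mulr0.
by rewrite em e eqxx in h.
Qed.

Lemma zcoefX gamma c p : zcoef (gamma + mdegZ c) ('X_[c] * p) = zcoef gamma p.
Proof.
rewrite {1 2}(mpolyE p) mulr_sumr.
rewrite [LHS](linear_sum (zcoef _ : {linear S -> k^o})).
rewrite [RHS](linear_sum (zcoef _ : {linear S -> k^o})).
apply: eq_bigr => m _; rewrite -!mul_mpolyC mulrCA -mpolyXD.
rewrite [LHS]zcoefC [RHS]zcoefC !zcoef_mono mdegZD [gamma + _]addrC.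
by rewrite (inj_eq (addrI _)).
Qed.

Lemma zcoef_neq0 gamma p j : zcoef gamma p != 0 -> 0 <= gamma j.
Proof.
rewrite /zcoef; have [<-|_] := eqVneq (mdegZ (mnm_abs gamma)) gamma.
  by rewrite ffunE.
by rewrite mul0r eqxx.
Qed.

(** The grading is fine: a degree contains at most one monomial. *)
Lemma homog_polyE gamma p : homog_poly gamma p ->
  p = (zcoef gamma p)%:MP * 'X_[mnm_abs gamma].
Proof.
move=> hp; apply/mpolyP => m; rewrite mcoeffCM mcoeffX.
have [/hp <-|] := boolP (m \in msupp p).
  by rewrite mnm_absK eqxx mulr1 zcoef_mdegZ.
move=> h; rewrite (memN_msupp_eq0 h); have [e|] := eqVneq (mnm_abs gamma) m.
  by rewrite /zcoef e (memN_msupp_eq0 h) mulr0 mul0r.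
by rewrite mulr0.
Qed.

Definition mnm_ind (T : {set 'I_n}) : 'X_{1..n} := [multinom (j \in T : nat) | j < n].

Lemma prod_mpolyX (T : {set 'I_n}) : \prod_(j in T) 'X_j = 'X_[mnm_ind T] :> S.
Proof.
rewrite -(big_morph _ (@mpolyXD n k) (@mpolyX0 n k)); congr 'X_[_].
apply/mnmP => j; rewrite mnm_sumE mnmE.
have [jT|jT] := boolP (j \in T).
  rewrite (bigD1 j) //= mnm1E eqxx big1 // => i /andP[_ /negbTE ij].
  by rewrite mnm1E ij.
rewrite big1 // => i iT; rewrite mnm1E.
by case: eqP jT => // <-; rewrite iT.
Qed.

End Multidegree.

(** * Coefficients on face rings and their localizations *)

Section StanleyReisnerCoefficients.
Variables (k : fieldType) (n : nat) (Gam : {set {set 'I_n}}).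
Hypothesis complexG : is_complex Gam.
Local Notation S := {mpoly k[n]}.
Local Notation Q := (SR k Gam).
Local Notation pi := (quotpi (SR_ideal (k := k) Gam)).
Implicit Types (gamma : multidegree n) (p : S) (e : 'X_{1..n}).

Lemma SR_ideal_mono (tau : {set 'I_n}) e p : tau \notin Gam ->
  (forall j, j \in tau -> (0 < e j)%N) -> (p * 'X_[e] : S^o) \in SR_ideal Gam.
Proof.
move=> tG te; apply/asboolP.
exists (fun t => if t == tau then p * 'X_[e - mnm_ind tau] else 0).
rewrite (bigD1 tau) //= eqxx [X in _ + X]big1 ?addr0 => [|t /andP[_ /negbTE ->]]; last first.
  by rewrite mul0r.
rewrite prod_mpolyX -mulrA -mpolyXD submK //.
apply/mnm_lepP => j; rewrite mnmE.
by case: (boolP (j \in tau)) => // /te.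
Qed.

(** Monomials of elements of the ideal have a nonface in their support, whereas all subsets of
    [pos_supp gamma] are faces. *)
Lemma zcoef_SR_ideal gamma p : pos_supp gamma \in Gam ->
  (p : S^o) \in SR_ideal Gam -> zcoef gamma p = 0.
Proof.
move=> gG /asboolP[g ->].
rewrite [LHS](linear_sum (zcoef _ : {linear S -> k^o})) big1 // => tau tG.
rewrite prod_mpolyX mulrC -[gamma](subrK (mdegZ (mnm_ind tau))).
rewrite [LHS]zcoefX; apply: contraNeq tG => nz.
apply: complexG gG; apply/fintype.subsetP => j jt; rewrite inE.
by have := zcoef_neq0 j nz; rewrite !ffunE mnmE jt subr_ge0; apply: lt_le_trans.
Qed.

(** Read off a representative, hence meaningful when [pos_supp gamma] is a face, by [SR_coef_pi]. *)
Definition SR_coef gamma (x : Q) : k := zcoef gamma (repr x : S^o).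

Lemma SR_coef_pi gamma p : pos_supp gamma \in Gam ->
  SR_coef gamma (pi (p : S^o)) = zcoef gamma p.
Proof.
move=> gG; apply/eqP; rewrite -subr_eq0; apply/eqP.
rewrite -[LHS](linearB (zcoef _ : {linear S -> k^o})).
by apply: zcoef_SR_ideal gG _; apply/quotpi_eq; rewrite quotpiK.
Qed.

Lemma SR_scale (s p : S) : s *: pi (p : S^o) = pi (s * p : S^o).
Proof. by rewrite -(linearZ_LR pi). Qed.

End StanleyReisnerCoefficients.

Section LocalizedCoefficients.
Variables (k : fieldType) (n : nat).
Local Notation S := {mpoly k[n]}.
Implicit Types (Gam : {set {set 'I_n}}) (T : {set 'I_n}).
Implicit Types (alpha beta : multidegree n) (p : S) (a e : 'X_{1..n}).

(* [k[Gam]] localized at [T] is one-dimensional in degree [alpha] if this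
   condition holds, and zero otherwise *)
Definition good Gam alpha T : bool :=
  (neg_supp alpha \subset T) && (T :|: pos_supp alpha \in Gam).

Lemma denom_exponent T (w : denom (monomials_in (k := k) T)) :
  exists2 a : 'X_{1..n}, (forall j, j \notin T -> a j = 0%N) & sval w = 'X_[a].
Proof. by case: w => w /= /asboolP. Qed.

Lemma denom_exponentP T (w : denom (monomials_in (k := k) T)) a :
  sval w = 'X_[a] -> forall j, j \notin T -> a j = 0%N.
Proof.
have [b hb ->] := denom_exponent w => /(congr1 (fun p => mlead p)).
by rewrite !mleadXm => <-.
Qed.

(** For a denominator ['X_[a]] the numerator is read in degree [alpha + mdegZ a]; [mlead] recovers
    [a]. *)
Definition coef_loc Gam alpha T (x : locT (SR k Gam) T) : k :=
  if good Gam alpha T then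
    SR_coef (alpha + mdegZ (mlead (sval (repr x).2))) (repr x).1
  else 0.

Section Complex.
Variable Gam : {set {set 'I_n}}.
Hypothesis complexG : is_complex Gam.
Local Notation Q := (SR k Gam).
Local Notation pi := (quotpi (SR_ideal (k := k) Gam)).

Lemma good_pos_supp alpha T (a : 'X_{1..n}) : good Gam alpha T ->
  (forall j, j \notin T -> a j = 0%N) -> pos_supp (alpha + mdegZ a) \in Gam.
Proof.
case/andP => _ TG aT; apply: complexG TG; apply/fintype.subsetP => j.
have [jT|jT] := boolP (j \in T); rewrite !inE ?jT // (negbTE jT) !ffunE (aT _ jT).
by rewrite addr0.
Qed.

(** Independence of the representative: after clearing denominators, both numerators are compared in
    degree [alpha + mdegZ (a' + a + c)], whose positive support is still a face. *)
Lemma coef_loc_frac alpha T p (w : denom (monomials_in T)) a :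
  good Gam alpha T -> sval w = 'X_[a] ->
  coef_loc alpha (mkfrac (pi (p : S^o)) w) = zcoef (alpha + mdegZ a) p.
Proof.
move=> gT ew; rewrite /coef_loc gT.
have [u uT] := repr_mkfrac (pi (p : S^o)) w.
case: (repr _) => m w' /=; have [a' a'T ew'] := denom_exponent w'.
have aT := denom_exponentP ew.
case/asboolP: uT => c cT ->; rewrite ew ew' mleadXm.
elim/quotpi_ind: m => p'; rewrite !scalerA !SR_scale -!mulrA => E.
rewrite SR_coef_pi //; last exact: good_pos_supp gT a'T.
have gP : pos_supp (alpha + mdegZ (a' + a + c)%MM) \in Gam.
  by apply: good_pos_supp gT _ => j jT; rewrite !mnmDE aT ?a'T ?cT.
have -> : zcoef (alpha + mdegZ a') p' =
    zcoef (alpha + mdegZ (a' + a + c)%MM) ('X_[c] * ('X_[a] * p')).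
  by rewrite !mdegZD !addrA !zcoefX.
have -> : zcoef (alpha + mdegZ a) p =
    zcoef (alpha + mdegZ (a' + a + c)%MM) ('X_[c] * ('X_[a'] * p)).
  by rewrite [(a' + a)%MM]addmC !mdegZD !addrA !zcoefX.
by rewrite -[LHS](SR_coef_pi complexG _ gP) -[RHS](SR_coef_pi complexG _ gP) E.
Qed.

Lemma coef_loc_linear alpha T (c : k) (x y : locT Q T) :
  coef_loc alpha (c%:MP *: x + y) = c * coef_loc alpha x + coef_loc alpha y.
Proof.
have [gT|/negbTE gT] := boolP (good Gam alpha T); last first.
  by rewrite /coef_loc gT mulr0 addr0.
elim/loc_ind: x => m w; elim/loc_ind: y => m' w'.
elim/quotpi_ind: m => p; elim/quotpi_ind: m' => p'.
have [a aT ew] := denom_exponent w; have [a' a'T ew'] := denom_exponent w'.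
rewrite mkfracZ mkfracD !scalerA !SR_scale -mulrA -linearD ew ew' /=.
rewrite (@coef_loc_frac _ _ _ _ (a + a')%MM) //= ?ew ?ew' ?mpolyXD //.
rewrite (coef_loc_frac _ gT ew) (coef_loc_frac _ gT ew').
rewrite [LHS](linearD (zcoef _ : {linear S -> k^o})) /=.
rewrite mdegZD addrA; congr (_ + _); last by rewrite addrAC zcoefX.
by rewrite zcoefX zcoefC.
Qed.

Lemma coef_loc0 alpha T : coef_loc alpha (0 : locT Q T) = 0.
Proof.
have := coef_loc_linear alpha 1 (0 : locT Q T) 0.
by rewrite scaler0 addr0 mul1r => /eqP; rewrite -subr_eq subrr eq_sym => /eqP.
Qed.

Lemma mkfrac0 T (w : denom (monomials_in T)) : mkfrac (0 : Q) w = 0 :> locT Q T.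
Proof. by apply: eq_mkfrac; rewrite !scaler0. Qed.

(** Multiplying by all variables in [T], which are invertible, brings the numerator into the
    ideal. *)
Lemma mkfrac_mono_eq0 T p e (w : denom (monomials_in T)) :
  T :|: [set j | (0 < e j)%N] \notin Gam ->
  mkfrac (pi (p * 'X_[e] : S^o)) w = 0 :> locT Q T.
Proof.
move=> TG; rewrite -(mkfrac0 w); apply/mkfracP; exists 'X_[mnm_ind T].
  by apply/asboolP; exists (mnm_ind T) => // j /negbTE jT; rewrite mnmE jT.
rewrite !scaler0 scalerA SR_scale -(linear0 pi); apply/quotpi_eq.
rewrite subr0.
rewrite [X in X \in _](_ : _ = sval w * p * 'X_[mnm_ind T + e]); last first.
  by rewrite mpolyXD; ring.
apply: SR_ideal_mono TG _ => j; rewrite !inE mnmDE mnmE.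
by case/orP => [->|h]; rewrite ?addSn // addn_gt0 h orbT.
Qed.

End Complex.
End LocalizedCoefficients.

(** * Moving between degrees with the same signs *)

Section Shift.
Variables (k : fieldType) (n : nat).
Local Notation S := {mpoly k[n]}.
Implicit Types (Gam : {set {set 'I_n}}) (T : {set 'I_n}).
Implicit Types (alpha beta : multidegree n) (p : S) (a e : 'X_{1..n}).

Definition mnm_pos alpha : 'X_{1..n} :=
  [multinom if (0 < alpha j)%R then `|alpha j|%N else 0%N | j < n].

(** Truncation to [T] makes this a denominator for every [T]. When [T] contains [neg_supp alpha],
    the Laurent monomial of degree [alpha] is ['X_[mnm_pos alpha]] over ['X_[mnm_neg alpha T]]. *)
Definition mnm_neg alpha T : 'X_{1..n} :=
  [multinom if (j \in T) && (alpha j < 0)%R then `|alpha j|%N else 0%N | j < n].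

Lemma mnm_negP alpha T j : j \notin T -> mnm_neg alpha T j = 0%N.
Proof. by rewrite mnmE => /negbTE ->. Qed.

Lemma mdegZ_pos_neg alpha T : neg_supp alpha \subset T ->
  mdegZ (mnm_pos alpha) = alpha + mdegZ (mnm_neg alpha T).
Proof.
move=> /fintype.subsetP sT; apply/ffunP => j; rewrite !ffunE !mnmE.
have := sT j; rewrite inE; case: ltrgt0P => h /=.
- by move=> _; rewrite andbF addr0 gtz0_abs.
- by move=> ->//=; rewrite ltz0_abs // addrN.
- by rewrite andbF addr0.
Qed.

Fact den_subproof alpha T : 'X_[mnm_neg alpha T] \in monomials_in (k := k) T.
Proof. by apply/asboolP; exists (mnm_neg alpha T) => // j; apply: mnm_negP. Qed.

Definition den alpha T : denom (monomials_in (k := k) T) :=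
  exist _ 'X_[mnm_neg alpha T] (den_subproof alpha T).

(** Inverse to [coef_loc] on the part of degree [alpha], by [coef_mono_loc] for good [T] and
    [homog_locE]. *)
Definition mono_loc Gam alpha T (c : k) : locT (SR k Gam) T :=
  if good Gam alpha T then
    mkfrac (quotpi (SR_ideal Gam) (c%:MP * 'X_[mnm_pos alpha] : S^o)) (den alpha T)
  else 0.

Lemma mono_loc_linear Gam alpha T (a c d : k) :
  mono_loc Gam alpha T (a * c + d) =
  a%:MP *: mono_loc Gam alpha T c + mono_loc Gam alpha T d.
Proof.
rewrite /mono_loc; case: ifP => _; last by rewrite scaler0 addr0.
rewrite mkfracZ SR_scale mkfracD; apply: eq_mkfrac => /=.
rewrite -scalerDr scalerA -linearD SR_scale SR_scale.
by congr quotpi; rewrite mpolyCD mpolyCM; ring.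
Qed.

Lemma mono_loc0 Gam alpha T : mono_loc Gam alpha T 0 = 0.
Proof.
have := mono_loc_linear Gam alpha T 1 0 0.
by rewrite mulr0 addr0 scale1r => /eqP; rewrite -subr_eq subrr eq_sym => /eqP.
Qed.

Lemma homog_mono_loc Gam alpha T c : homog_loc alpha (mono_loc Gam alpha T c).
Proof.
rewrite /mono_loc; case: ifP => [/andP[nT _]|_]; last first.
  exact: homog_cochain0.
exists (c%:MP * 'X_[mnm_pos alpha]), (den alpha T), (mnm_neg alpha T).
split=> //; rewrite -mdegZ_pos_neg //; apply: homog_polyC => m.
by rewrite msuppX inE => /eqP ->.
Qed.

Section Complex.
Variable Gam : {set {set 'I_n}}.
Hypothesis complexG : is_complex Gam.
Local Notation Q := (SR k Gam).
Local Notation pi := (quotpi (SR_ideal (k := k) Gam)).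

Lemma coef_mono_loc alpha T c : good Gam alpha T ->
  coef_loc alpha (mono_loc Gam alpha T c) = c.
Proof.
move=> gT; rewrite /mono_loc gT.
rewrite (coef_loc_frac (w := den alpha T) (a := mnm_neg alpha T) complexG _ gT) //.
case/andP: gT => nT _.
by rewrite zcoefC zcoef_mono (mdegZ_pos_neg nT) eqxx mulr1.
Qed.

Lemma homog_locE alpha T (x : locT Q T) : homog_loc alpha x ->
  mono_loc Gam alpha T (coef_loc alpha x) = x.
Proof.
case=> p [w [a [ew hp ->]]]; have aT := denom_exponentP ew.
rewrite (homog_polyE hp); set e := mnm_abs _; set c := zcoef _ _.
have cE : c = zcoef (alpha + mdegZ a) p by [].
have [c0|c0] := eqVneq c 0.
  by rewrite c0 mpolyC0 mul0r linear0 mkfrac0 coef_loc0 // mono_loc0.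
have eE : mdegZ e = alpha + mdegZ a.
  by apply: contraNeq c0 => /negbTE h; rewrite /c /zcoef -/e h mul0r.
have [gT|gT] := boolP (good Gam alpha T); last first.
  (* Outside [T] the denominator has exponent zero, so [alpha] agrees with [e] there. Were [T]
     together with the support of [e] a face, [T] would be good. *)
  rewrite /mono_loc (negbTE gT) mkfrac_mono_eq0 //.
  have ej j : j \notin T -> alpha j = (e j)%:Z.
    move=> jT; have := congr1 (fun g : multidegree n => g j) eE.
    by rewrite !ffunE (aT _ jT) addr0.
  apply: contra gT => gT; apply/andP; split.
    apply/fintype.subsetP => j; rewrite inE; apply: contraTT => /ej ->.
    by rewrite -leNgt.
  apply: complexG gT; apply/fintype.subsetP => j; rewrite !inE.
  by have [//|/ej ->] := boolP (j \in T).
rewrite (coef_loc_frac complexG _ gT ew) zcoefC zcoef_mono eE eqxx mulr1.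
rewrite /mono_loc gT; apply: eq_mkfrac; rewrite /= ew !SR_scale.
congr quotpi; rewrite [LHS]mulrCA [RHS]mulrCA -!mpolyXD; congr (_ * 'X_[_]).
rewrite -[LHS]mnm_absK -[RHS]mnm_absK !mdegZD eE (mdegZ_pos_neg (andP gT).1).
by congr mnm_abs; rewrite addrCA [RHS]addrCA; congr (_ + _); apply: addrC.
Qed.

Lemma good_subD1 alpha T j : good Gam alpha T -> ~~ good Gam alpha (T :\ j) ->
  (j \in T) && (alpha j < 0).
Proof.
case/andP => nT TG; apply: contraNT => h; apply/andP; split.
  rewrite finset.subsetD1 nT /= inE; apply: contra h => h.
  by rewrite h andbT; apply: (fintype.subsetP nT); rewrite inE.
by apply: complexG TG; apply: finset.setSU; apply: finset.subD1set.
Qed.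

(** If [T :\ j] is not good then [alpha j < 0], while [j] is absent from the denominator of [x], so
    the coefficient vanishes on both sides. *)
Lemma coef_loc_res alpha T j (x : locT Q (T :\ j)) : good Gam alpha T ->
  coef_loc alpha (face_res Q T j x) = coef_loc alpha x.
Proof.
move=> gT; elim/loc_ind: x => m w; elim/quotpi_ind: m => p.
have [a aT ew] := denom_exponent w; rewrite [face_res _ _ _ _]loc_res_frac.
rewrite [LHS](coef_loc_frac (a := a) complexG _ gT) //.
have [gTj|gTj] := boolP (good Gam alpha (T :\ j)).
  by rewrite (coef_loc_frac complexG _ gTj ew).
have /andP[jT jneg] := good_subD1 gT gTj.
rewrite /coef_loc (negbTE gTj); apply/eqP; apply: contraTT jneg.
move=> /(zcoef_neq0 j); rewrite !ffunE aT ?addr0 -?leNgt //.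
by rewrite !inE eqxx.
Qed.

Lemma mono_loc_res alpha T j c :
  face_res Q T j (mono_loc Gam alpha (T :\ j) c) =
  if good Gam alpha (T :\ j) then mono_loc Gam alpha T c else 0.
Proof.
rewrite /mono_loc; case: ifP => [gTj|_]; last by rewrite linear0.
rewrite [LHS]loc_res_frac; have [gT|gT] := boolP (good Gam alpha T).
  apply: eq_mkfrac => /=; congr ('X_[_] *: _); apply/mnmP => l; rewrite !mnmE.
  case/andP: gT => /fintype.subsetP nT _; case/andP: gTj => /fintype.subsetP nTj _.
  have [h|h] := boolP (alpha l < 0); last by rewrite !andbF.
  by rewrite nT ?nTj // inE.
rewrite mkfrac_mono_eq0 //; apply: contra gT => gT; apply/andP; split.
  case/andP: gTj => h _; apply: fintype.subset_trans h _; exact: finset.subD1set.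
apply: complexG gT; apply: finset.setUS; apply/fintype.subsetP => l.
by rewrite !inE mnmE => h; rewrite h absz_gt0 gt_eqF.
Qed.

Definition same_supp alpha beta : Prop :=
  neg_supp alpha = neg_supp beta /\ pos_supp alpha = pos_supp beta.

(** For degrees with the same signs: projection onto degree [alpha], then multiplication by the
    Laurent monomial of degree [beta - alpha]. The projection makes it defined on all cochains. *)
Definition shift alpha beta T (x : locT Q T) : locT Q T :=
  mono_loc Gam beta T (coef_loc alpha x).

Lemma same_supp_good alpha beta T : same_supp alpha beta ->
  good Gam alpha T = good Gam beta T.
Proof. by rewrite /good => -[-> ->]. Qed.

Lemma shift_res alpha beta T j (x : locT Q (T :\ j)) : same_supp alpha beta ->
  face_res Q T j (shift alpha beta x) = shift alpha beta (face_res Q T j x).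
Proof.
move=> ab; rewrite /shift mono_loc_res -(same_supp_good _ ab).
have [gT|gT] := boolP (good Gam alpha T); last first.
  by rewrite /mono_loc -(same_supp_good _ ab) (negbTE gT) if_same.
rewrite coef_loc_res //; case: ifP => // gTj.
by rewrite {1}/coef_loc gTj mono_loc0.
Qed.

Lemma shiftK alpha beta T (x : locT Q T) : same_supp alpha beta ->
  homog_loc alpha x -> shift beta alpha (shift alpha beta x) = x.
Proof.
move=> ab hx; rewrite /shift.
have [gT|gT] := boolP (good Gam beta T); first by rewrite coef_mono_loc // homog_locE.
rewrite /mono_loc (same_supp_good _ ab) (negbTE gT).
rewrite -(same_supp_good _ ab) in gT.
by rewrite -[RHS](homog_locE hx) /mono_loc (negbTE gT).
Qed.

End Complex.

Section Restriction.
Variables (Gam Gam' : {set {set 'I_n}}) (sG : Gam' \subset Gam).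
Hypotheses (complexG : is_complex Gam) (complexG' : is_complex Gam').

Lemma goodS alpha T : good Gam' alpha T -> good Gam alpha T.
Proof. by case/andP => nT /(fintype.subsetP sG) TG; apply/andP. Qed.

Lemma coef_loc_surj alpha T (x : locT (SR k Gam) T) : good Gam' alpha T ->
  coef_loc alpha (locT_map (SR_surj k sG) T x) = coef_loc alpha x.
Proof.
move=> gT; elim/loc_ind: x => m w; elim/quotpi_ind: m => p.
have [a aT ew] := denom_exponent w; rewrite [locT_map _ _ _]loc_map_frac SR_surj_pi.
by rewrite (coef_loc_frac complexG' _ gT ew) (coef_loc_frac complexG _ (goodS gT) ew).
Qed.

Lemma shift_surj alpha beta T (x : locT (SR k Gam) T) : same_supp alpha beta ->
  locT_map (SR_surj k sG) T (shift alpha beta x) =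
  shift alpha beta (locT_map (SR_surj k sG) T x).
Proof.
move=> ab; rewrite /shift; have [gT'|gT'] := boolP (good Gam' beta T).
  have gT := goodS gT'; rewrite coef_loc_surj; last first.
    by rewrite (same_supp_good _ _ ab).
  by rewrite /mono_loc gT gT' [LHS]loc_map_frac SR_surj_pi.
rewrite {2}/mono_loc (negbTE gT') /mono_loc; case: ifP => [gT|_]; last by rewrite linear0.
rewrite [LHS]loc_map_frac SR_surj_pi mkfrac_mono_eq0 //.
apply: contra gT' => gT'; case/andP: gT => nT _; apply/andP; split=> //.
apply: complexG' gT'; apply: finset.setUS; apply/fintype.subsetP => l.
by rewrite !inE mnmE => h; rewrite h absz_gt0 gt_eqF.
Qed.

End Restriction.
End Shift.

(** * Cohomology in a fixed degree *)

Section Cohomology.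
Variables (k : fieldType) (n : nat).
Local Notation S := {mpoly k[n]}.
Implicit Types (Gam : {set {set 'I_n}}) (T A : {set 'I_n}).
Implicit Types (alpha beta : multidegree n) (p : S).

Section Complex.
Variable Gam : {set {set 'I_n}}.
Hypothesis complexG : is_complex Gam.
Local Notation Q := (SR k Gam).
Local Notation pi := (quotpi (SR_ideal (k := k) Gam)).

Lemma coef_locD alpha T (x y : locT Q T) :
  coef_loc alpha (x + y) = coef_loc alpha x + coef_loc alpha y.
Proof.
by have := coef_loc_linear complexG alpha 1 x y; rewrite mpolyC1 scale1r mul1r.
Qed.

Lemma coef_locZ alpha T (a : k) (x : locT Q T) :
  coef_loc alpha (a%:MP *: x) = a * coef_loc alpha x.
Proof.
by rewrite -[_ *: x]addr0 (coef_loc_linear complexG) coef_loc0 // addr0.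
Qed.

Lemma shift_linear alpha beta T (a : k) (x y : locT Q T) :
  shift alpha beta (a%:MP *: x + y) =
  a%:MP *: shift alpha beta x + shift alpha beta y.
Proof. by rewrite /shift (coef_loc_linear complexG) mono_loc_linear. Qed.

Lemma shift0 alpha beta T : shift alpha beta (0 : locT Q T) = 0.
Proof. by rewrite /shift coef_loc0 // mono_loc0. Qed.

Lemma shiftD alpha beta T (x y : locT Q T) :
  shift alpha beta (x + y) = shift alpha beta x + shift alpha beta y.
Proof. by have := shift_linear alpha beta 1 x y; rewrite mpolyC1 !scale1r. Qed.

Lemma shiftZ alpha beta T (a : k) (x : locT Q T) :
  shift alpha beta (a%:MP *: x) = a%:MP *: shift alpha beta x.
Proof. by rewrite -[_ *: x]addr0 shift_linear shift0 addr0. Qed.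

Lemma mpoly_sign m : (-1) ^+ m = ((-1) ^+ m)%:MP :> S.
Proof. by rewrite rmorphXn /= mpolyCN mpolyC1. Qed.

Definition shift_cochain alpha beta (c : cochains Q) : cochains Q :=
  fun T => shift alpha beta (c T).

Lemma shift_cochain_linear alpha beta (a : k) (c c' : cochains Q) :
  shift_cochain alpha beta (a%:MP *: c + c') =
  a%:MP *: shift_cochain alpha beta c + shift_cochain alpha beta c'.
Proof. by apply: functional_extensionality_dep => T; apply: shift_linear. Qed.

Lemma shift_is_cochain A q alpha beta (c : cochains Q) :
  is_cochain A q c -> is_cochain A q (shift_cochain alpha beta c).
Proof. by move=> hc T /hc cT; rewrite /shift_cochain cT shift0. Qed.

Lemma homog_shift_cochain alpha beta (c : cochains Q) :
  homog_cochain beta (shift_cochain alpha beta c).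
Proof. by move=> T; apply: homog_mono_loc. Qed.

Lemma shift_cochain_d A alpha beta (c : cochains Q) : same_supp alpha beta ->
  cech_d A (shift_cochain alpha beta c) = shift_cochain alpha beta (cech_d A c).
Proof.
move=> ab; apply: functional_extensionality_dep => T.
rewrite /shift_cochain /cech_d; case: ifP => _; last by rewrite shift0.
rewrite (big_morph _ (@shiftD alpha beta T) (@shift0 alpha beta T)).
by apply: eq_bigr => j _; rewrite shift_res // mpoly_sign shiftZ.
Qed.

Lemma shift_cochainK alpha beta (c : cochains Q) : same_supp alpha beta ->
  homog_cochain alpha c ->
  shift_cochain beta alpha (shift_cochain alpha beta c) = c.
Proof.
by move=> ab hc; apply: functional_extensionality_dep => T; apply: shiftK.
Qed.

Section Class.
Variables (A : {set 'I_n}) (alpha beta : multidegree n).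
Hypothesis ab : same_supp alpha beta.
Local Notation Z q := (submod (cocycles (M := Q) A q)).

Fact shift_cocycle_subproof q (z : Z q) :
  shift_cochain alpha beta (submod_val z) \in cocycles A q.
Proof.
have /asboolP[hz dz] := submodP z; apply/asboolP; split; first exact: shift_is_cochain.
rewrite shift_cochain_d // dz; apply: functional_extensionality_dep => T.
exact: shift0.
Qed.

Definition shift_cocycle q (z : Z q) : Z q := Submod (shift_cocycle_subproof z).

Lemma shift_cocycle_linear q (a : k) (z z' : Z q) :
  shift_cocycle (a%:MP *: z + z') = a%:MP *: shift_cocycle z + shift_cocycle z'.
Proof. by apply: submod_inj; apply: shift_cochain_linear. Qed.

Lemma quotpi_restr_linear q (a : k) (z z' : Z q) :
  quotpi (coboundaries A q) (a%:MP *: z + z') =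
  a *: (quotpi (coboundaries A q) z : restr (local_cohomology Q A q)) +
  (quotpi (coboundaries A q) z' : restr (local_cohomology Q A q)).
Proof. exact: linearP. Qed.

Lemma shift_coboundary q (z : Z q) :
  z \in coboundaries A q -> shift_cocycle z \in coboundaries A q.
Proof.
move=> hz; have {}hz := asboolW hz; apply/asboolP.
case: q z hz => [|p] z.
  move=> ->; apply: submod_inj; apply: functional_extensionality_dep => T.
  exact: shift0.
case=> b hb ez; exists (shift_cochain alpha beta b); first exact: shift_is_cochain.
by rewrite shift_cochain_d // -ez.
Qed.

Lemma quotpi_shift q (z z' : Z q) :
  quotpi (coboundaries A q) z = quotpi (coboundaries A q) z' ->
  quotpi (coboundaries A q) (shift_cocycle z) =
  quotpi (coboundaries A q) (shift_cocycle z').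
Proof.
move=> /quotpi_eq/shift_coboundary h; apply/quotpi_eq; move: h.
have -> : z - z' = (-1)%:MP *: z' + z by rewrite mpolyCN mpolyC1 scaleN1r addrC.
by rewrite shift_cocycle_linear mpolyCN mpolyC1 scaleN1r addrC.
Qed.

Variable q : nat.
Local Notation Va := (graded_piece k Gam A q alpha).
Local Notation Vb := (graded_piece k Gam A q beta).

(** The chosen representative need not be homogeneous: [shift_cochain] lands in degree [beta]
    anyway, and [quotpi_shift] removes the dependence on the choice. *)
Fact shift_class_subproof (h : Va) :
  (quotpi (coboundaries A q) (shift_cocycle (repr (submod_val h)))
     : restr (local_cohomology Q A q)) \in homog_class beta.
Proof.
apply/asboolP; exists (shift_cocycle (repr (submod_val h))) => //.
exact: homog_shift_cochain.
Qed.

Definition shift_class (h : Va) : Vb := Submod (shift_class_subproof h).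

Lemma shift_classE (h : Va) (z : Z q) :
  submod_val h = quotpi (coboundaries A q) z ->
  submod_val (shift_class h) = quotpi (coboundaries A q) (shift_cocycle z).
Proof. by move=> e; apply: quotpi_shift; rewrite quotpiK. Qed.

Lemma shift_class_linear : linear shift_class.
Proof.
move=> a u v; apply: submod_inj.
have eu := esym (quotpiK (submod_val u)); have ev := esym (quotpiK (submod_val v)).
pose axy (x y : restr (local_cohomology Q A q)) := a *: x + y.
rewrite (@shift_classE _ (a%:MP *: repr (submod_val u)
  + repr (submod_val v))).
  rewrite shift_cocycle_linear; apply: etrans (quotpi_restr_linear _ _ _) _.
  exact: (congr2 axy (esym (shift_classE eu)) (esym (shift_classE ev))).
exact: etrans (congr2 axy eu ev) (esym (quotpi_restr_linear _ _ _)).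
Qed.

HB.instance Definition _ := GRing.isLinear.Build k Va Vb _ shift_class shift_class_linear.

End Class.
End Complex.
End Cohomology.

(** * Comparison, vanishing and finiteness of graded pieces *)

Section GradedPieces.
Variables (k : fieldType) (n : nat).
Local Notation S := {mpoly k[n]}.
Implicit Types (Gam : {set {set 'I_n}}) (T A : {set 'I_n}).
Implicit Types (alpha beta : multidegree n) (p : S).

Lemma same_supp_sym alpha beta : same_supp alpha beta -> same_supp beta alpha.
Proof. by case=> e1 e2; split. Qed.

Lemma graded_pieceE Gam A q alpha (h : graded_piece k Gam A q alpha) :
  exists2 z : submod (cocycles (M := SR k Gam) A q),
    homog_cochain alpha (submod_val z) &
    submod_val h = quotpi (coboundaries A q) z.
Proof. by have /asboolP := submodP h. Qed.

Lemma shift_class_bij Gam (cG : is_complex Gam) A q alpha beta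
    (ab : same_supp alpha beta) : bijective (@shift_class k n Gam cG A _ _ ab q).
Proof.
have K a b (s : same_supp a b) (s' : same_supp b a) :
    cancel (@shift_class k n Gam cG A _ _ s q) (@shift_class k n Gam cG A _ _ s' q).
  move=> h; apply: submod_inj; have [z hz e] := graded_pieceE h.
  rewrite (shift_classE cG s' (shift_classE cG s e)) e; congr quotpi.
  by apply: submod_inj; apply: shift_cochainK.
by exists (shift_class cG (same_supp_sym ab) (q := q)); apply: K.
Qed.

Lemma shift_class_nat Gam Gam' (sG : Gam' \subset Gam) (cG : is_complex Gam)
    (cG' : is_complex Gam') A q alpha beta (ab : same_supp alpha beta)
    (h : graded_piece k Gam A q alpha) :
  shift_class cG' ab (graded_piece_map k sG A q alpha h) =
  graded_piece_map k sG A q beta (shift_class cG ab h).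
Proof.
apply: submod_inj; have [z hz e] := graded_pieceE h.
have e1 : submod_val (graded_piece_map k sG A q alpha h) =
    quotpi (coboundaries A q) (cocycle_map A (SR_surj k sG) q z).
  by rewrite -local_cohomology_map_pi -e.
rewrite (shift_classE cG' ab e1).
rewrite -[RHS]/(local_cohomology_map A (SR_surj k sG) q
  (submod_val (shift_class cG ab h))).
rewrite (shift_classE cG ab e) local_cohomology_map_pi; congr quotpi.
apply: submod_inj; apply: functional_extensionality_dep => T.
exact: esym (shift_surj sG cG cG' (submod_val z T) ab).
Qed.

Section Complex.
Variables (Gam : {set {set 'I_n}}) (A : {set 'I_n}) (q : nat).
Variable alpha : multidegree n.
Hypothesis cG : is_complex Gam.
Local Notation Q := (SR k Gam).

Lemma homog_cochain_eq (c c' : cochains Q) :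
  homog_cochain alpha c -> homog_cochain alpha c' ->
  (forall T, good Gam alpha T -> coef_loc alpha (c T) = coef_loc alpha (c' T)) ->
  c = c'.
Proof.
move=> hc hc' e; apply: functional_extensionality_dep => T.
rewrite -(homog_locE cG (hc T)) -(homog_locE cG (hc' T)).
have [gT|gT] := boolP (good Gam alpha T); first by rewrite e.
by rewrite /mono_loc (negbTE gT).
Qed.

Lemma graded_piece_eq0_bad :
  (forall T, T \subset A -> ~~ good Gam alpha T) ->
  forall h : graded_piece k Gam A q alpha, h = 0.
Proof.
move=> bad h; apply: submod_inj; have [z hz ->] := graded_pieceE h.
suff -> : z = 0 by rewrite linear0.
apply: submod_inj; apply: homog_cochain_eq hz (homog_cochain0 _ _ _) _ => T gT.
have TA : ~~ (T \subset A) by apply: contraL gT; apply: bad.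
have /asboolP[hc _] := submodP z.
by rewrite hc // (negbTE TA).
Qed.

(** Lets a primitive be built for all [q] at once, the case [q = 0] being split off only here. *)
Lemma mem_coboundaries (z : submod (cocycles (M := Q) A q)) (b : cochains Q) :
  submod_val z = cech_d A b -> (forall r, q = r.+1 -> is_cochain A r b) ->
  (q = 0%N -> b = 0) -> z \in coboundaries A q.
Proof.
move=> zb hb hb0; apply/asboolP; case: q z zb hb hb0 => [|p] z zb hb hb0.
  by apply: submod_inj; rewrite zb hb0 // linear0.
by exists b; first exact: hb.
Qed.

Definition face_sign T (l : 'I_n) : k := (-1) ^+ #|[set m in T | (m < l)%N]|.

Lemma face_sign_sq T l : face_sign T l * face_sign T l = 1.
Proof. by rewrite /face_sign -exprD addnn -mul2n exprM sqrrN !expr1n. Qed.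

Lemma face_signU1 T j l : j \notin T ->
  face_sign (j |: T) l = (-1) ^+ (j < l)%N * face_sign T l.
Proof.
move=> jT; rewrite /face_sign -exprD; congr (_ ^+ _).
rewrite (cardsD1 j) !inE eqxx /=; congr (_ + _)%N; apply: eq_card => m.
by rewrite !inE; have [->|] := eqVneq m j; rewrite ?(negbTE jT).
Qed.

Lemma face_signD1 T j l : j \in T ->
  face_sign (T :\ j) l = (-1) ^+ (j < l)%N * face_sign T l.
Proof.
move=> jT; rewrite -{2}(finset.setD1K jT) face_signU1 ?inE ?eqxx //.
by rewrite mulrA -expr2 sqrr_sign mul1r.
Qed.

Lemma coef_loc_cech_d (c : cochains Q) T : T \subset A -> good Gam alpha T ->
  coef_loc alpha (cech_d A c T) =
  \sum_(l in T) face_sign T l * coef_loc alpha (c (T :\ l)).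
Proof.
move=> TA gT; rewrite /cech_d TA.
rewrite (big_morph _ (@coef_locD k n Gam cG alpha T) (@coef_loc0 k n Gam cG alpha T)).
by apply: eq_bigr => l _; rewrite mpoly_sign coef_locZ // coef_loc_res.
Qed.

(* If [alpha j > 0] then [T] is good if and only if [j |: T] is, and
   [b T = +- c (j |: T)] is a contracting homotopy *)
Lemma graded_piece_eq0_pos j : j \in A -> 0 < alpha j ->
  forall h : graded_piece k Gam A q alpha, h = 0.
Proof.
move=> jA j0 h; apply: submod_inj; have [z hz ->] := graded_pieceE h.
have /asboolP[zq dz] := submodP z; set c := submod_val z in hz zq dz *.
have goodU T : good Gam alpha (j |: T) = good Gam alpha T.
  have jN : j \notin neg_supp alpha by rewrite inE -leNgt ltW.
  rewrite /good -finset.setUA [_ :|: (_ :|: _)](finset.setUidPr _); last first.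
    by rewrite finset.sub1set !inE j0 orbT.
  congr (_ && _); apply/idP/idP => [/fintype.subsetP sT|sT].
    apply/fintype.subsetP => l lN; have := sT _ lN; rewrite !inE.
    by case: eqP => // lj; rewrite lj (negbTE jN) in lN.
  exact: fintype.subset_trans sT (finset.subsetUr _ _).
pose b : cochains Q := fun T => if j \in T then 0 else
  mono_loc Gam alpha T (face_sign T j * coef_loc alpha (c (j |: T))).
have hb T : homog_loc alpha (b T).
  by rewrite /b; case: ifP => _; [exact: homog_cochain0|exact: homog_mono_loc].
have cb T : coef_loc alpha (b T) =
    (j \notin T)%:R * (face_sign T j * coef_loc alpha (c (j |: T))).
  rewrite /b; case: (j \in T); first by rewrite coef_loc0 // mul0r.
  rewrite mul1r; have [gT|gT] := boolP (good Gam alpha T).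
    by rewrite coef_mono_loc.
  by rewrite /coef_loc goodU (negbTE gT) mulr0.
have bdeg T (Tq : j \notin T -> ~~ ((j |: T \subset A) && (#|j |: T| == q))) :
    b T = 0.
  rewrite /b; case: ifP => // jT.
  by rewrite zq ?Tq ?jT // coef_loc0 // mulr0 mono_loc0.
(* Being homogeneous, [b] is its own shift from [alpha] to [alpha], and shifts commute with the
   differential. *)
have hdb : homog_cochain alpha (cech_d A b).
  rewrite (_ : b = shift_cochain alpha alpha b) ?shift_cochain_d //.
    exact: homog_shift_cochain.
  by apply: functional_extensionality_dep => T; rewrite /shift_cochain /shift homog_locE.
have db : c = cech_d A b.
  apply: homog_cochain_eq => // T gT; have [TA|TA] := boolP (T \subset A); last first.
    by rewrite zq ?(negbTE TA) // /cech_d (negbTE TA).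
  rewrite coef_loc_cech_d //; under eq_bigr => l _ do rewrite cb.
  (* If [j \in T], only the face [T :\ j] contributes, as [b] vanishes on sets containing [j].
     Otherwise the cocycle equation at [j |: T] expresses [c T] through the other faces. *)
  have [jT|jT] := boolP (j \in T).
    rewrite (bigD1 j) //= big1 ?addr0 => [|l /andP[lT lj]]; last first.
      by rewrite !inE eq_sym lj jT mul0r mulr0.
    rewrite !inE eqxx mul1r finset.setD1K // face_signD1 // ltnn /= expr0 mul1r mulrA.
    by rewrite face_sign_sq mul1r.
  have jTA : j |: T \subset A by rewrite finset.subUset finset.sub1set jA.
  have := coef_loc_cech_d c jTA; rewrite goodU => /(_ gT).
  rewrite dz coef_loc0 // big_setU1 //= finset.setU1K // => /esym/eqP.
  rewrite addr_eq0 face_signU1 // ltnn /= expr0 mul1r => /eqP e.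
  transitivity (face_sign T j * (face_sign T j * coef_loc alpha (c T))).
    by rewrite mulrA face_sign_sq mul1r.
  rewrite e mulrN mulr_sumr -sumrN.
  apply: eq_bigr => l lT.
  have lj : l != j by apply: contraNneq jT => <-.
  have -> : (j |: T) :\ l = j |: (T :\ l).
    apply/setP => m; rewrite !inE; case: (eqVneq m j) => [->|//].
    by rewrite eq_sym lj.
  have -> : j \notin T :\ l by rewrite !inE (negbTE jT) andbF.
  rewrite mul1r face_signU1 // face_signD1 //.
  (* Exactly one of [j < l] and [l < j] holds; this gives the sign that cancels. *)
  have -> : (-1) ^+ (j < l)%N = - (-1) ^+ (l < j)%N :> k.
    by move: lj; rewrite -(inj_eq val_inj) /=; case: ltngtP => // _ _;
      rewrite ?expr1 ?expr0 ?opprK.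
  by ring.
apply: etrans _ (linear0 (quotpi (coboundaries A q))); apply/quotpi_eq; rewrite subr0.
apply: (@mem_coboundaries z b) => [//|p ep T Tp|q0].
  rewrite bdeg // => jT; apply: contra Tp.
  by rewrite ep finset.subUset cardsU1 jT eqSS => /andP[/andP[_ ->] ->].
apply: functional_extensionality_dep => T; rewrite bdeg // => jT.
by rewrite cardsU1 jT q0 andbF.
Qed.

(** Homogeneous representatives are determined by one coefficient at each [T], so a relation between
    these rows of coefficients is one between the classes. *)
Lemma graded_piece_dim_le : dim_le (graded_piece k Gam A q alpha) #|{set 'I_n}|.
Proof.
move=> d b hb.
have /choice[z hz] l : exists z : submod (cocycles (M := Q) A q),
    homog_cochain alpha (submod_val z) /\
    submod_val (b l) = quotpi (coboundaries A q) z.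
  by have [z h1 h2] := graded_pieceE (b l); exists z.
pose M := \matrix_(l < d, r < #|{set 'I_n}|)
  coef_loc alpha (submod_val (z l) (enum_val r)).
suff : row_free M.
  by rewrite -row_leq_rank => /leq_trans; apply; apply: rank_leq_col.
apply: inj_row_free => u uM; apply/rowP => l; rewrite [RHS]mxE; move: l.
apply: hb; apply: submod_inj.
(* Cocycles carry polynomial scalars and classes scalars of [k]; sums over lists let the two be
   matched by induction. *)
pose Zu (r : seq 'I_d) := \sum_(l <- r) (u 0 l)%:MP *: z l.
have Zu_homog r : homog_cochain alpha (submod_val (Zu r)).
  elim: r => [|l r IH]; first by rewrite /Zu big_nil; apply: homog_cochain0.
  by rewrite /Zu big_cons; apply: homog_cochainP => //; case: (hz l).
have Zu_coef r T : coef_loc alpha (submod_val (Zu r) T) =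
    \sum_(l <- r) u 0 l * coef_loc alpha (submod_val (z l) T).
  elim: r => [|l r IH]; rewrite /Zu ?big_nil ?big_cons; first exact: coef_loc0.
  by rewrite -IH; apply: coef_loc_linear.
have Zu_class r : quotpi (coboundaries A q) (Zu r) =
    submod_val (\sum_(l <- r) u 0 l *: b l).
  elim: r => [|l r IH]; rewrite /Zu ?big_nil ?big_cons; first exact: linear0.
  apply: etrans (quotpi_restr_linear _ _ _) _; rewrite -/(Zu r) IH.
  by case: (hz l) => _ <-.
rewrite -Zu_class (_ : Zu _ = 0) ?linear0 //; apply: submod_inj.
apply: (homog_cochain_eq (Zu_homog _) (homog_cochain0 _ _ _)) => T _.
rewrite Zu_coef [RHS]coef_loc0 //.
have := congr1 (fun w : 'rV_#|{set 'I_n}| => w 0 (enum_rank T)) uM.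
rewrite !mxE => e; rewrite -[RHS]e; apply: eq_bigr => l _.
by rewrite mxE enum_rankK.
Qed.

End Complex.
End GradedPieces.

(** * The sublevel filtration as a finite chain *)

Section LocalPmod.
Variables (k : fieldType) (R : realType) (n : nat).
Variables (Delta : {set {set 'I_n}}) (f : {set 'I_n} -> R).

Lemma graded_piece_map_bij (Gam Gam' : {set {set 'I_n}}) (sG : Gam' \subset Gam)
    A q alpha : Gam \subset Gam' -> bijective (graded_piece_map k sG A q alpha).
Proof.
move=> sG'; exists (graded_piece_map k sG' A q alpha) => x;
  by rewrite (graded_piece_map_comp _ _ (fintype.subxx _)) graded_piece_map_id.
Qed.

Lemma finite_Crit : finite_set (Crit Delta f).
Proof.
rewrite (_ : Crit Delta f = (f @` [set` Delta])%classic).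
  by apply: finite_image; apply: finite_finset.
by apply/seteqP; split=> t /= [tau h e]; exists tau.
Qed.

Lemma sublevel_constant (s t : R) : s <= t ->
  ([set` `[s, t]] `&` Crit Delta f = set0)%classic ->
  sublevel Delta f t \subset sublevel Delta f s.
Proof.
move=> st noC; apply/fintype.subsetP => sigma; rewrite !inE => /andP[sD ft].
rewrite sD leNgt; apply/negP => sf.
suff : (set0 : set R) (f sigma) by [].
by rewrite -noC; split; [apply/mem_set; rewrite /= in_itv /= ft ltW|exists sigma].
Qed.

Hypothesis Delta_complex : is_complex Delta.
Hypothesis f_monotonic : monotonic Delta f.

Lemma sublevel_complex t : is_complex (sublevel Delta f t).
Proof.
move=> tau sigma ts; rewrite !inE => /andP[sD fs].
have tD := Delta_complex ts sD; rewrite tD.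
exact: le_trans (f_monotonic tD sD ts) fs.
Qed.

(** Sublevels are nested, so their cardinality can index the chain; a face enters at the cardinality
    of the sublevel of its own value. An index that is not attained repeats the complex of the last
    attained one. *)
Definition step (j : 'I_#|Delta|.+1) : {set {set 'I_n}} :=
  [set sigma in Delta | (#|sublevel Delta f (f sigma)| <= j)%N].

Lemma stepS (i j : 'I_#|Delta|.+1) : (i <= j)%N -> step i \subset step j.
Proof.
move=> ij; apply/fintype.subsetP => sigma; rewrite !inE => /andP[-> h].
exact: leq_trans h ij.
Qed.

Lemma step_complex j : is_complex (step j).
Proof.
move=> tau sigma ts; rewrite !inE => /andP[sD fs].
have tD := Delta_complex ts sD; rewrite tD; apply: leq_trans fs.
by apply/subset_leq_card/sublevelS/f_monotonic.
Qed.

Fact level_subproof t : (#|sublevel Delta f t| < #|Delta|.+1)%N.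
Proof.
by rewrite ltnS; apply/subset_leq_card/fintype.subsetP => s; rewrite inE => /andP[].
Qed.

Definition level t := Ordinal (level_subproof t).

Lemma level_mono s t : s <= t -> (level s <= level t)%N.
Proof. by move=> st; apply/subset_leq_card/sublevelS. Qed.

(** If [f sigma > t], the sublevel of [f sigma] also contains [sigma], hence is strictly larger than
    that of [t]. *)
Lemma step_level t : step (level t) = sublevel Delta f t.
Proof.
apply/setP => sigma; rewrite !inE; case: (boolP (sigma \in Delta)) => //= sD.
apply/idP/idP => [|ft]; last exact/subset_leq_card/sublevelS.
apply: contraTT; rewrite -ltNge -ltnNge => ft; apply: proper_card.
apply/properP; split; first exact/sublevelS/ltW.
by exists sigma; rewrite inE sD /= ?lexx // -ltNge.
Qed.

Section Module.
Variables (i : 'I_n) (q : nat).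

Fact step_id alpha (j : 'I_#|Delta|.+1) (jj : (j <= j)%N) v :
  graded_piece_map k (stepS jj) [set~ i] q alpha v = v.
Proof. exact: graded_piece_map_id. Qed.

Fact step_comp alpha (h j l : 'I_#|Delta|.+1) (hj : (h <= j)%N) (jl : (j <= l)%N)
    (hl : (h <= l)%N) v :
  graded_piece_map k (stepS hj) [set~ i] q alpha
    (graded_piece_map k (stepS jl) [set~ i] q alpha v) =
  graded_piece_map k (stepS hl) [set~ i] q alpha v.
Proof. exact: graded_piece_map_comp. Qed.

Definition step_mod alpha : chain_mod k #|Delta|.+1 :=
  ChainMod (@step_id alpha) (@step_comp alpha).

Lemma local_pmod_decomposable alpha : exists N (J : 'I_N -> rinterval R),
  interval_decomposition (local_pmod k Delta f i q alpha) J.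
Proof.
have [N [D]] : exists N, inhabited (chain_decomposition (step_mod alpha) N).
  apply: (@chain_decomposable _ _ _ (fun=> #|{set 'I_n}|)) => j.
  exact/graded_piece_dim_le/step_complex.
have sub t : step (level t) \subset sublevel Delta f t by rewrite step_level.
(* The equality [step_level] is used as an inclusion, so that a [graded_piece_map] replaces a
   transport. *)
pose phi t : {linear local_pmod k Delta f i q alpha t -> step_mod alpha (level t)} :=
  graded_piece_map k (sub t) [set~ i] q alpha.
apply: (@chain_interval_decomposition _ _ _ _ _ level level_mono phi _ _ _ D)
  => [t|s t st v].
  by apply: graded_piece_map_bij; rewrite step_level.
have sub' : step (level s) \subset sublevel Delta f t.
  by rewrite step_level; apply: sublevelS.
apply: etrans (graded_piece_map_comp _ _ sub' _) _.
exact/esym/graded_piece_map_comp.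
Qed.

Lemma local_pmod_iso alpha beta : same_supp alpha beta ->
  pmod_iso (local_pmod k Delta f i q alpha) (local_pmod k Delta f i q beta).
Proof.
move=> ab; exists (fun t => shift_class (sublevel_complex (t := t)) ab (q := q)).
split=> [t|s t st v]; first exact: shift_class_bij.
exact: shift_class_nat.
Qed.

End Module.
End LocalPmod.

Theorem theorem3p10 (k : fieldType) (R : realType) (n : nat)
    (Delta : {set {set 'I_n}}) (f : {set 'I_n} -> R)
    (Delta_complex : is_complex Delta)
    (Delta_vertices : forall j : 'I_n, [set j]%SET \in Delta)
    (f_monotonic : monotonic Delta f)
    (i : 'I_n) (q : nat) (alpha : multidegree n) :
  let V (beta : multidegree n) : pmod k R := local_pmod k Delta f i q beta in
  [/\ pointwise_fin_dim (V alpha) /\ constructible (V alpha) (Crit Delta f),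
      exists (N : nat) (J : 'I_N -> rinterval R),
        interval_decomposition (V alpha) J /\
        forall (N' : nat) (J' : 'I_N' -> rinterval R),
          interval_decomposition (V alpha) J' ->
          exists h : 'I_N -> 'I_N',
            bijective h /\ forall l, J l = J' (h l) :> set R,
      [\/ pmod_zero (V alpha),
          exists2 sigma, sigma \in deletion Delta i &
            pmod_iso (V alpha) (V (face_degree i 0 sigma)) |
          exists2 sigma, sigma \in link Delta i &
            pmod_iso (V alpha) (V (face_degree i 1 sigma))] &
      q_tame (V alpha)].
Proof.
move=> V.
have cS t : is_complex (sublevel Delta f t) by exact: sublevel_complex.
have V_zero beta (v0 : forall t (h : local_obj k Delta f i q beta t), h = 0) :
  pmod_zero (V beta) by [].
have V_iso beta : same_supp alpha beta -> pmod_iso (V alpha) (V beta).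
  by move=> ab; apply: local_pmod_iso.
have Vdim t := @graded_piece_dim_le k n _ [set~ i] q alpha (cS t).
split.
- split=> [t|].
    have [d [b [hb sb]]] := dim_le_basis (Vdim t).
    by exists d; apply: basis_vector_axiom sb.
  split; first exact: finite_Crit.
  by move=> s t st noC; apply: graded_piece_map_bij; apply: sublevel_constant noC.
- have [N [J VJ]] : exists N (J : 'I_N -> rinterval R),
      interval_decomposition (V alpha) J.
    exact: local_pmod_decomposable.
  by exists N, J; split=> // N' J'; apply: interval_decomposition_unique.
(* If [alpha i < 0], a good set contains [i], whereas the Cech complex only uses sets avoiding
   [i]. *)
- have [neg|nneg] := ltP (alpha i) 0.
    apply: Or31; apply: V_zero => t; apply: graded_piece_eq0_bad => // T Ti.
    apply/negP => /andP[/fintype.subsetP nT _].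
    have /nT/(fintype.subsetP Ti) : i \in neg_supp alpha by rewrite inE.
    by rewrite !inE eqxx.
  have [/existsP[j /andP[ji j0]]|noj] :=
      boolP [exists j, (j \in [set~ i]) && (0 < alpha j)].
    by apply: Or31; apply: V_zero => t; apply: graded_piece_eq0_pos ji j0.
  have posj j : j != i -> (0 < alpha j) = false.
    move=> ji; apply/negbTE/negP => j0; case/existsP: noj; exists j.
    by rewrite !inE ji.
  have negi : i \notin neg_supp alpha by rewrite inE -leNgt.
  (* Now [pos_supp alpha] is empty or [[set i]], so [alpha] has the signs of a face degree with [c]
     equal to 0 or 1. *)
  pose c : int := (0 < alpha i)%R%:Z.
  have ab : same_supp alpha (face_degree i c (neg_supp alpha)).
    split; apply/setP => j; rewrite !inE ffunE.
      have [->|ji] := eqVneq j i; first by rewrite /c ltNge nneg; case: (0 < _).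
      by rewrite inE; case: (alpha j < 0).
    have [->|ji] := eqVneq j i; first by rewrite /c; case: (0 < _).
    by rewrite posj // inE; case: (alpha j < 0).
  (* If this union is not a face of [Delta], no set is good in any sublevel. *)
  have [inD|ninD] := boolP (neg_supp alpha :|: pos_supp alpha \in Delta); last first.
    apply: Or31; apply: V_zero => t; apply: graded_piece_eq0_bad => // T _.
    apply: contra ninD => /andP[nT]; rewrite inE => /andP[TD _].
    by apply: Delta_complex TD; apply: finset.setSU.
  (* With [i] in the positive support, the union being a face puts [neg_supp alpha] in the link;
     otherwise it lies in the deletion. *)
  move: inD ab; rewrite /c; case: (ltP 0 (alpha i)) => [i0|i0] inD ab.
    apply: Or33; exists (neg_supp alpha); last exact: V_iso.
    rewrite inE negi; apply: Delta_complex inD.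
    by rewrite finset.subUset finset.subsetUl finset.sub1set !inE i0 orbT.
  apply: Or32; exists (neg_supp alpha); last exact: V_iso.
  rewrite inE negi andbT; apply: Delta_complex inD; exact: finset.subsetUl.
- move=> s t st _; have [d [b [_ sb]]] := dim_le_basis (Vdim t).
  exists d, b => v; have [c ->] := sb v; exists c; rewrite linear_sum.
  by apply: eq_bigr => l _; rewrite linearZ_LR.
Qed.
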